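(* Let the setting and notation be as in the context, and let $r_n(t)=|\overline f_n(t)-e^{-t^2/2}|$. (i) Let $\gamma>0$ and either $\varepsilon\in(0,\infty]$ and $L^3=L_{E,n}^3(\varepsilon,\gamma)$, $p=p_E$, or $\varepsilon\in(0,\infty)$ and $L^3=L_{R,n}^3(\varepsilon,\gamma)$, $p=p_R$ (with $L>0$). Then for $L|t|<\overline\tau_0(\varepsilon)$, $$r_n(t)\le\Big(\exp\{L^3p(t,\varepsilon,\gamma)+L^4t^4B(L|t|,\varepsilon,L)\}-1\Big)e^{-t^2/2}.$$ In particular, for $L^3=L_{E,n}^3(\infty,\gamma)$ and $L|t|<2^{5/6}/\sqrt3=1.0287\ldots$, $$r_n(t)\le\Big(\exp\Big\{\tfrac{\sqrt{6\varkappa\gamma^2+1}}{6\gamma}L^3|t|^3-4\sqrt2\cdot3^{-3/2}\big[\ln(1-3\cdot2^{-5/3}L^2t^2)+3\cdot2^{-5/3}L^2t^2\big]\Big\}-1\Big)e^{-t^2/2}.$$ The right-hand side of the general bound in (i) is monotonically increasing in $L>0$ and monotonically decreasing in $\gamma>0$, and, for $L^3=L_{E,n}^3$, also in $\varepsilon>0$; for $L^3=L_{R,n}^3(\varepsilon,\gamma)$ it does not depend on $\gamma$ for $\gamma\ge\gamma_*$. (ii) If $L^3=L_{E,n}^3(\varepsilon,\gamma)$, $L\le\overline L_0(\varepsilon)$ and $L|t|<\tau\le\overline\tau_0(\varepsilon)$, then $$r_n(t)\le A_E(\tau,\varepsilon,\gamma,L)\big(p_E(t,\varepsilon,\gamma)+B(\tau,\varepsilon)Lt^4\big)L^3e^{-t^2/2};$$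 in particular, for $\varepsilon=\infty$ (and $L|t|<\tau<2^{5/6}/\sqrt3$), $$r_n(t)\le\exp\Big\{\tfrac{\tau^3}{6\gamma}+\sqrt{\tfrac\varkappa6}\tau^3+\tau^4B(\tau)\Big\}\Big(\tfrac{\sqrt{6\varkappa\gamma^2+1}}{6\gamma}+B(\tau)L|t|\Big)L^3|t|^3e^{-t^2/2},$$ where $B(\tau)=B(\tau,\infty)=\sqrt3\cdot2^{-1/6}/(2^{5/3}-3\tau^2)$. This right-hand side (of the general bound in the Esseen case) is monotonically increasing in $L>0$ and monotonically decreasing in $\varepsilon>0$ and $\gamma>0$. If $L^3=L_{R,n}^3(\varepsilon,\gamma)$, $L\le\overline L_0(\varepsilon)$ and $L|t|<\tau\le\overline\tau_0(\varepsilon)$, then $$r_n(t)\le A_R(\tau,\varepsilon,\gamma,L)\big(p_R(t,\varepsilon,\gamma)+B(\tau,\varepsilon)Lt^4\big)L^3e^{-h(\tau,\varepsilon,L)t^2/2},$$ where $h(\tau,\varepsilon,L)=1-\varepsilon\tau^2L/6$, which is positive for all $\tau\in(0,\overline\tau_0(\varepsilon))$ if and only if $L\le6/(\varepsilon\overline\tau_0^2(\varepsilon))$; this right-hand side is monotonically increasing in $L>0$ and monotonically decreasing in $\gamma>0$.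
   Context: $X_1,\dots,X_n$ are independent real random variables with $\mathbb E X_k=0$, $\sigma_k^2=\mathbb E X_k^2<\infty$, normalized so that $\sum_k\sigma_k^2=1$; $f_k(t)=\mathbb E e^{itX_k}$, $\overline f_n(t)=\prod_kf_k(t)$. For $z\ge0$, $L_n(z)=\sum_k\mathbb E X_k^2\mathbf 1(|X_k|\ge z)$; for $z>0$, $M_n(z)=\sum_k\mathbb E X_k^3\mathbf 1(|X_k|<z)$. $L_{E,n}^3(\varepsilon,\gamma)=\sup_{0<z\le\varepsilon}\{\gamma|M_n(z)|+zL_n(z)\}$ ($\varepsilon\in(0,\infty]$), $L_{R,n}^3(\varepsilon,\gamma)=\gamma|M_n(\varepsilon)|+\sup_{0<z\le\varepsilon}zL_n(z)$ ($\varepsilon\in(0,\infty)$). Constants: $\varkappa=0.5315\ldots=\sup_{x>0}x^{-2}\sqrt{(\cos x-1+x^2/2)^2+(\sin x-x)^2}$, $\gamma_*=1/\sqrt{6\varkappa}$. Functions: $\alpha(\varepsilon)=\inf_{0<x<\min\{\varepsilon,1\}}(x-x^3)^{-2/3}$ (equal to $(\varepsilon-\varepsilon^3)^{-2/3}$ if $\varepsilon\le1/\sqrt3$, else $3\cdot2^{-2/3}$); $\overline\tau_0(\varepsilon)=\sqrt{2/\alpha(\varepsilon)}$; $\overline L_0(\varepsilon)=\varepsilon\overline\tau_0(\varepsilon)$; $\alpha_1(\varepsilon,L)=\min_{0<u\le\varepsilon/L}(\frac u2+\frac{\alpha(\varepsilon)}{4u})$, i.e. $\sqrt{\alpha(\varepsilon)/2}$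 if $L\le\overline L_0(\varepsilon)$ and $\frac\varepsilon{2L}+\frac{\alpha(\varepsilon)L}{4\varepsilon}$ otherwise. For $0<\tau<\overline\tau_0(\varepsilon)$: $B(\tau,\varepsilon,L)=-\frac{4\alpha_1(\varepsilon,L)}{\alpha^2(\varepsilon)\tau^4}[\ln(1-\frac12\alpha(\varepsilon)\tau^2)+\frac12\alpha(\varepsilon)\tau^2]$, $B(\tau,\varepsilon)=\frac{\sqrt{\alpha(\varepsilon)/2}}{2-\alpha(\varepsilon)\tau^2}$, $A(\tau,\varepsilon)=\exp\{\tau^4B(\tau,\varepsilon)\}$, $A_E(\tau,\varepsilon,\gamma,L)=A(\tau,\varepsilon)\exp\{\frac{\tau^3}{6\gamma}+\sqrt{\frac\varkappa3}\tau^3+\frac\varkappa\varepsilon L\tau^2\}$, $A_R(\tau,\varepsilon,\gamma,L)=A(\tau,\varepsilon)\exp\{\frac{\tau^3}{6\gamma}\mathbf 1(\gamma<\gamma_* )+\frac\varkappa\varepsilon L\tau^2\}$. Finally $p_E(t,\varepsilon,\gamma)=t^2\min_{0<z\le\varepsilon}[\frac{zt^2}{12}+\max\{\frac{|t|}{6\gamma},\frac\varkappa z-\frac{zt^2}{24}\}]$ and $p_R(t,\varepsilon,\gamma)=t^2\max\{\frac{|t|}{6\gamma},\frac\varkappa\varepsilon+\frac{\varepsilon t^2}{24},\frac{\varepsilon t^2}{12}\}$. *)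

(* Defs.v *)
From HB Require Import structures.
From mathcomp Require Import all_boot all_order all_algebra.
From mathcomp Require Import all_classical all_reals all_analysis.
From mathcomp Require Import complex.
Set Implicit Arguments. Unset Strict Implicit. Unset Printing Implicit Defensive.
Import Order.TTheory GRing.Theory Num.Theory.
Local Open Scope classical_set_scope.
Local Open Scope ring_scope.

Section Defs.
Variable R : realType.

Definition kappa : R :=
  sup [set (x ^- 2) * Num.sqrt ((cos x - 1 + x ^+ 2 / 2) ^+ 2 + (sin x - x) ^+ 2)
      | x in [set x : R | 0 < x]].

Definition gamma_star : R := (Num.sqrt (6 * kappa))^-1.

Definition inv_e (e : \bar R) : R :=
  match e with EFin x => x^-1 | _ => 0 end.

Definition alpha (e : \bar R) : R :=
  inf [set (x - x ^+ 3) `^ (- (2 / 3))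
      | x in [set x : R | 0 < x /\ (x%:E < e)%E /\ x < 1]].

Definition tau0 (e : \bar R) : R := Num.sqrt (2 / alpha e).

Definition L0 (e : \bar R) : \bar R := (e * (tau0 e)%:E)%E.

Definition alpha1 (e : \bar R) (L : R) : R :=
  inf [set u / 2 + alpha e / (4 * u)
      | u in [set u : R | 0 < u /\ ((u * L)%:E <= e)%E]].

Definition B3 (tau : R) (e : \bar R) (L : R) : R :=
  - (4 * alpha1 e L) / (alpha e ^+ 2 * tau ^+ 4)
    * (ln (1 - alpha e * tau ^+ 2 / 2) + alpha e * tau ^+ 2 / 2).

Definition B2 (tau : R) (e : \bar R) : R :=
  Num.sqrt (alpha e / 2) / (2 - alpha e * tau ^+ 2).

Definition Afun (tau : R) (e : \bar R) : R := expR (tau ^+ 4 * B2 tau e).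

Definition A_E (tau : R) (e : \bar R) (g L : R) : R :=
  Afun tau e * expR (tau ^+ 3 / (6 * g) + Num.sqrt (kappa / 3) * tau ^+ 3
                     + kappa * inv_e e * L * tau ^+ 2).

Definition A_R (tau eps g L : R) : R :=
  Afun tau eps%:E * expR (tau ^+ 3 / (6 * g) * (if g < gamma_star then 1 else 0)
                          + kappa / eps * L * tau ^+ 2).

Definition p_E (t : R) (e : \bar R) (g : R) : R :=
  t ^+ 2 * inf [set z * t ^+ 2 / 12 + Num.max (`|t| / (6 * g)) (kappa / z - z * t ^+ 2 / 24)
               | z in [set z : R | 0 < z /\ (z%:E <= e)%E]].

Definition p_R (t eps g : R) : R :=
  t ^+ 2 * Num.max (`|t| / (6 * g))
             (Num.max (kappa / eps + eps * t ^+ 2 / 24) (eps * t ^+ 2 / 12)).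

Definition h_fun (tau eps L : R) : R := 1 - eps * tau ^+ 2 * L / 6.

Definition rhs1_E (t : R) (e : \bar R) (g L : R) : R :=
  (expR (L ^+ 3 * p_E t e g + L ^+ 4 * t ^+ 4 * B3 (L * `|t|) e L) - 1)
  * expR (- (t ^+ 2) / 2).

Definition rhs1_R (t eps g L : R) : R :=
  (expR (L ^+ 3 * p_R t eps g + L ^+ 4 * t ^+ 4 * B3 (L * `|t|) eps%:E L) - 1)
  * expR (- (t ^+ 2) / 2).

Definition rhs2_E (t tau : R) (e : \bar R) (g L : R) : R :=
  A_E tau e g L * (p_E t e g + B2 tau e * L * t ^+ 4) * L ^+ 3 * expR (- (t ^+ 2) / 2).

Definition rhs2_R (t tau eps g L : R) : R :=
  A_R tau eps g L * (p_R t eps g + B2 tau eps%:E * L * t ^+ 4) * L ^+ 3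
  * expR (- (h_fun tau eps L * t ^+ 2) / 2).

(* B(τ) = B(τ,∞) = √3·2^{-1/6}/(2^{5/3} - 3τ^2) *)
Definition B_inf (tau : R) : R :=
  Num.sqrt 3 * 2 `^ (- (1 / 6)) / (2 `^ (5 / 3) - 3 * tau ^+ 2).

Local Open Scope complex_scope.

Context {d : measure_display} {T : measurableType d} (P : probability T R).

Definition mutually_independent (n : nat) (X : 'I_n -> {RV P >-> R}) : Prop :=
  forall B : 'I_n -> set R, (forall k, measurable (B k)) ->
    P (\bigcap_(k in [set: 'I_n]) (X k @^-1` B k)) = (\prod_(k < n) P (X k @^-1` B k))%E.

Definition charfun (X : {RV P >-> R}) (t : R) : R[i] :=
  (fine ('E_P[fun w => cos (t * X w)]) +i* fine ('E_P[fun w => sin (t * X w)]))%C.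

Definition fbar (n : nat) (X : 'I_n -> {RV P >-> R}) (t : R) : R[i] :=
  \prod_(k < n) charfun (X k) t.

Definition r_n (n : nat) (X : 'I_n -> {RV P >-> R}) (t : R) : R :=
  Normc.normc (fbar X t - (expR (- (t ^+ 2) / 2))%:C).

Local Close Scope complex_scope.

Definition L_n (n : nat) (X : 'I_n -> {RV P >-> R}) (z : R) : R :=
  \sum_(k < n) fine ('E_P[fun w => X k w ^+ 2 * (if z <= `|X k w| then 1 else 0)]).

Definition M_n (n : nat) (X : 'I_n -> {RV P >-> R}) (z : R) : R :=
  \sum_(k < n) fine ('E_P[fun w => X k w ^+ 3 * (if `|X k w| < z then 1 else 0)]).

Definition LE3 (n : nat) (X : 'I_n -> {RV P >-> R}) (e : \bar R) (g : R) : \bar R :=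
  ereal_sup [set (g * `|M_n X z| + z * L_n X z)%:E
            | z in [set z : R | 0 < z /\ (z%:E <= e)%E]].

Definition LR3 (n : nat) (X : 'I_n -> {RV P >-> R}) (eps g : R) : \bar R :=
  ((g * `|M_n X eps|)%:E
   + ereal_sup [set (z * L_n X z)%:E | z in [set z : R | (0 < z)%R /\ (z <= eps)%R]])%E.

End Defs.

(* Main.v *)
Require Import Defs.
From HB Require Import structures.
From mathcomp Require Import all_boot all_order all_algebra.
From mathcomp Require Import all_classical all_reals all_analysis.
From mathcomp Require Import measurable_realfun.
From mathcomp Require Import complex ring lra.
Import Order.TTheory GRing.Theory Num.Theory.
Import numFieldNormedType.Exports.
Local Open Scope classical_set_scope.
Local Open Scope ring_scope.

(** With [w_k = f_k(t) - 1], [a_k = sigma_k^2 t^2 / 2] and [D = sum_k (w_k + a_k)],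
    integrating the logarithmic derivative of [e^(s t^2/2) prod_k (1 + s w_k)]
    over [0 <= s <= 1] bounds [r_n(t)] by
    [(exp (|D| + sum_k (- ln (1 - a_k) - a_k)) - 1) e^(-t^2/2)]; independence enters
    only through the product form of [fbar].
    Cutting [X_k] at the level [z] and using the fourth-order Taylor remainder below
    it and [kappa] above it bounds [|D|] in terms of [M_n(z)], [z L_n(z)] and
    [sum_k E X_k^2 min(X_k^2, z^2) = int_0^z 2 y L_n(y) dy <= 2 z L^3].
    The same integral, together with [sigma_k^2 <= alpha L^2] (cut at [z = x sigma_k]),
    gives [sum_k sigma_k^4 <= 4 alpha_1 L^4], and since [(- ln (1 - x) - x) / x^2]
    increases, this controls the logarithmic remainders.
    Part (ii) follows from [e^x - 1 <= x e^x]. *)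

(** * Taylor bounds and the logarithmic remainder *)

(** A modulus [|z|] is mostly bounded through the linear forms [u Re z + v Im z] with
    [u^2 + v^2 = 1]. Such a form is real and commutes with expectation, so an estimate on a
    characteristic function becomes one scalar inequality in [x], proved by comparing derivatives
    and then integrated. The cut level is free in each use, and the infima in the constants record
    its optimization: [alpha] comes from cutting at [x sigma_k], [alpha1] from cutting at [u L], and
    the minimum in [p_E] from the cut of [D]. In the Rozovskii case [M_n] is controlled at the level
    [eps] alone, so the cut of [D] is fixed there and [p_R] is a plain maximum. Both fractions enter
    the bounds on [sigma_k^2] and on the sum of the [sigma_k^4] only through [y L_n(y) <= L^3];
    [M_n] matters in [D] alone. *)

Section real_analysis.
Variable R : realType.
Implicit Types (f : R -> R) (x y u v : R).

Lemma le_of_is_derive_ge0 f (df : R -> R) (b : R) : 0 <= b ->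
  (forall x, 0 <= x <= b -> is_derive x 1 f (df x)) ->
  (forall x, 0 <= x <= b -> 0 <= df x) -> f 0 <= f b.
Proof.
move=> b0 fdf df0.
have [|||c] := @MVT_segment R f df 0 b.
- exact: b0.
- by move=> x; rewrite in_itv/= => /andP[x0 xb]; apply: fdf; rewrite !ltW.
- apply: derivable_within_continuous => x; rewrite in_itv/= => xb.
  by have [] := fdf x xb.
rewrite in_itv/= => cb fb; rewrite -subr_ge0 fb mulr_ge0 ?df0//.
by rewrite subr0.
Qed.

Lemma le_of_is_derive_le f g (df dg : R -> R) (b : R) : 0 <= b ->
  (forall x, 0 <= x <= b -> is_derive x 1 f (df x)) ->
  (forall x, 0 <= x <= b -> is_derive x 1 g (dg x)) ->
  (forall x, 0 <= x <= b -> df x <= dg x) -> f 0 <= g 0 -> f b <= g b.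
Proof.
move=> b0 fdf gdg dfg fg0.
suff : (g - f) 0 <= (g - f) b by rewrite !fctE; lra.
apply: (@le_of_is_derive_ge0 _ (dg - df) _ b0) => x xb.
  by apply: is_deriveB; [exact: gdg|exact: fdf].
by rewrite !fctE subr_ge0 dfg.
Qed.

(** Lagrange's identity: the gap between the squares of the two sides is [(u y - v x)^2]. Together
    with [sqrt_le_of_dot] it identifies a Euclidean norm with the supremum of its linear forms. *)
Lemma dot_cauchy u v x y : u ^+ 2 + v ^+ 2 = 1 ->
  u * x + v * y <= Num.sqrt (x ^+ 2 + y ^+ 2).
Proof.
move=> uv; rewrite (le_trans (ler_norm _))// -sqrtr_sqr ler_sqrt; last first.
  by rewrite addr_ge0 ?sqr_ge0.
have -> : x ^+ 2 + y ^+ 2 = (u ^+ 2 + v ^+ 2) * (x ^+ 2 + y ^+ 2) by rewrite uv mul1r.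
have := sqr_ge0 (u * y - v * x); lra.
Qed.

Lemma dot_cos_sin u v x : u ^+ 2 + v ^+ 2 = 1 -> u * cos x + v * sin x <= 1.
Proof.
by move=> uv; rewrite (le_trans (dot_cauchy _ _ (cos x) (sin x) uv))// cos2Dsin2 sqrtr1.
Qed.

(** The forms of this and the next three lemmas are rotated Taylor remainders of [exp (i x)]; the
    derivative of each is the form of the previous order, and the chain starts at [dot_cos_sin]. *)
Lemma taylor1_dot u v x : u ^+ 2 + v ^+ 2 = 1 -> 0 <= x ->
  u * sin x + v * (1 - cos x) <= x.
Proof.
move=> uv x0.
apply: (@le_of_is_derive_le (fun x => u * sin x + v * (1 - cos x)) id
  (fun x => u * cos x + v * sin x) (fun=> 1) x) => //.
- by move=> y _; apply: is_derive_eq; rewrite ?scaler1 /GRing.scale/=; ring.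
- by move=> y _; exact: dot_cos_sin.
- by rewrite sin0 cos0; lra.
Qed.

Lemma taylor2_dot u v x : u ^+ 2 + v ^+ 2 = 1 -> 0 <= x ->
  u * (1 - cos x) + v * (x - sin x) <= x ^+ 2 / 2.
Proof.
move=> uv x0.
apply: (@le_of_is_derive_le (fun x => u * (1 - cos x) + v * (x - sin x))
  (fun x => x ^+ 2 / 2)
  (fun x => u * sin x + v * (1 - cos x)) id x) => //.
- by move=> y _; apply: is_derive_eq; rewrite ?scaler1 /GRing.scale/=; ring.
- by move=> y _; apply: is_derive_eq; rewrite ?scaler1 /GRing.scale/=; field.
- by move=> y /andP[y0 _]; exact: taylor1_dot.
- by rewrite sin0 cos0; lra.
Qed.

Lemma taylor3_dot u v x : u ^+ 2 + v ^+ 2 = 1 -> 0 <= x ->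
  u * (x - sin x) + v * (x ^+ 2 / 2 - 1 + cos x) <= x ^+ 3 / 6.
Proof.
move=> uv x0.
apply: (@le_of_is_derive_le (fun x => u * (x - sin x) + v * (x ^+ 2 / 2 - 1 + cos x))
  (fun x => x ^+ 3 / 6)
  (fun x => u * (1 - cos x) + v * (x - sin x)) (fun x => x ^+ 2 / 2) x) => //.
- by move=> y _; apply: is_derive_eq; rewrite ?scaler1 /GRing.scale/=; field.
- by move=> y _; apply: is_derive_eq; rewrite ?scaler1 /GRing.scale/=; field.
- by move=> y /andP[y0 _]; exact: taylor2_dot.
- by rewrite sin0 cos0; lra.
Qed.

Lemma taylor4_dot u v x : u ^+ 2 + v ^+ 2 = 1 ->
  u * (cos x - 1 + x ^+ 2 / 2) + v * (sin x - x + x ^+ 3 / 6) <= x ^+ 4 / 24.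
Proof.
(* Complex conjugation: [x -> -x] together with [v -> -v] fixes the form. *)
wlog x0 : v x / 0 <= x => [wx uv|].
  have [x0|x0] := leP 0 x; first exact: wx.
  have := wx (- v) (- x); rewrite oppr_ge0 (ltW x0) sqrrN => /(_ isT uv).
  rewrite cosN sinN; lra.
move=> uv.
apply: (@le_of_is_derive_le
  (fun x => u * (cos x - 1 + x ^+ 2 / 2) + v * (sin x - x + x ^+ 3 / 6))
  (fun x => x ^+ 4 / 24)
  (fun x => u * (x - sin x) + v * (x ^+ 2 / 2 - 1 + cos x)) (fun x => x ^+ 3 / 6) x) => //.
- by move=> y _; apply: is_derive_eq; rewrite ?scaler1 /GRing.scale/=; field.
- by move=> y _; apply: is_derive_eq; rewrite ?scaler1 /GRing.scale/=; field.
- by move=> y /andP[y0 _]; exact: taylor3_dot.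
- by rewrite sin0 cos0; lra.
Qed.

Lemma taylor2_dot_real u v x : u ^+ 2 + v ^+ 2 = 1 ->
  u * (cos x - 1) + v * (sin x - x) <= x ^+ 2 / 2.
Proof.
move=> uv; have uv' : (- u) ^+ 2 + (- v) ^+ 2 = 1 by rewrite !sqrrN.
have [x0|x0] := leP 0 x; first by have := taylor2_dot _ _ _ uv' x0; lra.
have uv2 : (- u) ^+ 2 + v ^+ 2 = 1 by rewrite !sqrrN.
have x0' : 0 <= - x by lra.
by have := taylor2_dot _ _ _ uv2 x0'; rewrite cosN sinN; lra.
Qed.

Let kset : set R :=
  [set (x ^- 2) * Num.sqrt ((cos x - 1 + x ^+ 2 / 2) ^+ 2 + (sin x - x) ^+ 2)
      | x in [set x : R | 0 < x]].

(** The unit vector along [(a, b)] attains the norm; [0 <= c] settles the zero vector, which has no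
    direction. *)
Lemma sqrt_le_of_dot a b c : 0 <= c ->
  (forall u v, u ^+ 2 + v ^+ 2 = 1 -> u * a + v * b <= c) ->
  Num.sqrt (a ^+ 2 + b ^+ 2) <= c.
Proof.
move=> c0 H; set r := Num.sqrt _.
have r2 : r ^+ 2 = a ^+ 2 + b ^+ 2 by rewrite sqr_sqrtr// addr_ge0 ?sqr_ge0.
have [->//|r0] := eqVneq r 0.
have := H (a / r) (b / r).
have -> : (a / r) ^+ 2 + (b / r) ^+ 2 = 1.
  by rewrite !expr_div_n -mulrDl -r2 divff// expf_neq0.
have -> : a / r * a + b / r * b = r.
  by apply: (mulIf r0); rewrite -expr2 r2; field.
exact.
Qed.

(** The modulus [|exp (i x) - 1 - i x|] is at most [x^2 / 2], and the added [x^2 / 2] contributes as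
    much again, whence the bound 1. The [sup] of an unbounded set would be the default value 0. *)
Lemma kappa_has_ubound : has_ubound kset.
Proof.
exists 1 => _ [x /= x0 <-].
rewrite mulrC ler_pdivrMr ?exprn_gt0// mul1r.
apply: sqrt_le_of_dot => [|u v uv]; first exact: sqr_ge0.
have h := taylor2_dot_real _ _ x uv.
have u1 : u <= 1 by have := sqr_ge0 v; nra.
have := sqr_ge0 x; nra.
Qed.

Lemma kappa_gt0 : 0 < kappa R.
Proof.
apply: (@lt_le_trans _ _ (pi ^- 2 * Num.sqrt ((cos pi - 1 + pi ^+ 2 / 2) ^+ 2
   + (sin pi - pi : R) ^+ 2))); last first.
  by apply: ub_le_sup; [exact: kappa_has_ubound|exists pi => //=; exact: pi_gt0].
have pi0 := pi_gt0 R.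
rewrite mulr_gt0 ?invr_gt0 ?exprn_gt0// sqrtr_gt0 ltr_wpDl ?sqr_ge0//.
by rewrite sinpi sub0r sqrrN exprn_gt0.
Qed.

Lemma kappa_dot u v x : u ^+ 2 + v ^+ 2 = 1 ->
  u * (cos x - 1 + x ^+ 2 / 2) + v * (sin x - x) <= kappa R * x ^+ 2.
Proof.
wlog x0 : v x / 0 < x => [wx uv|uv].
  have [x0|x0|x0] := ltgtP 0 x; first exact: wx.
    have := wx (- v) (- x); rewrite oppr_gt0 x0 sqrrN => /(_ isT uv).
    rewrite cosN sinN; lra.
  by rewrite -x0 sin0 cos0; lra.
apply: (le_trans (dot_cauchy _ _ _ _ uv)).
rewrite -ler_pdivrMr ?exprn_gt0// mulrC.
by apply: ub_le_sup; [exact: kappa_has_ubound|exists x].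
Qed.

(** The series [x^2/2 + x^3/3 + ...]. At [x = alpha tau^2 / 2] it is the negative of the bracket in
    [B3]. *)
Definition log_rem x : R := - ln (1 - x) - x.

Lemma is_derive_log_rem (a s : R) : s * a < 1 ->
  is_derive s 1 (fun s => log_rem (s * a)) (s * a ^+ 2 / (1 - s * a)).
Proof.
move=> sa; rewrite /log_rem.
have h : 0 < 1 - s * a by lra.
have hl := @is_derive1_ln R _ h.
have hl2 : is_derive s 1 (fun s : R => ln (1 - s * a)) (- a / (1 - s * a)).
  have hg : is_derive s 1 (fun s : R => 1 - s * a) (- a).
    by apply: is_derive_eq; rewrite /GRing.scale/=; ring.
  by have := @is_derive1_comp R (@ln R) (fun s => 1 - s * a) s _ _ hl hg; rewrite mulrC.
by apply: is_derive_eq; rewrite /GRing.scale/=; field; lra.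
Qed.

Let lt1_of (x s : R) : 0 <= x < 1 -> 0 <= s <= 1 -> s * x < 1.
Proof. by move=> /andP[x0 x1] /andP[s0 s1]; nra. Qed.

Lemma log_rem0 : log_rem 0 = 0.
Proof. by rewrite /log_rem !subr0 ln1 oppr0. Qed.

Lemma log_rem_ge0 x : 0 <= x < 1 -> 0 <= log_rem x.
Proof.
move=> x01.
have := @le_of_is_derive_ge0 (fun s => log_rem (s * x))
  (fun s => s * x ^+ 2 / (1 - s * x)) 1 ler01.
rewrite mul0r mul1r log_rem0; apply => s s01; have h := lt1_of _ _ x01 s01.
  exact: is_derive_log_rem.
case/andP: s01 => s0 _; rewrite divr_ge0 ?mulr_ge0 ?sqr_ge0//; lra.
Qed.

(** [log_rem x / x^2] increases; clearing denominators admits [x = 0]. Along the rays [s x] and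
    [s y] the two sides have derivatives [s x^2 y^2] divided by [1 - s x] and by the smaller
    [1 - s y]. *)
Lemma log_rem_ratio x y : 0 <= x -> x <= y -> y < 1 ->
  log_rem x * y ^+ 2 <= log_rem y * x ^+ 2.
Proof.
move=> x0 xy y1.
have x01 : 0 <= x < 1 by lra.
have y01 : 0 <= y < 1 by lra.
have y0 : 0 <= y by lra.
have := @le_of_is_derive_le (fun s => log_rem (s * x) * y ^+ 2)
  (fun s => log_rem (s * y) * x ^+ 2)
  (fun s => s * x ^+ 2 / (1 - s * x) * y ^+ 2)
  (fun s => s * y ^+ 2 / (1 - s * y) * x ^+ 2) 1 ler01.
rewrite !mul0r !mul1r log_rem0 !mul0r lexx; apply => // s s01.
- have h := is_derive_log_rem _ _ (lt1_of _ _ x01 s01).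
  by apply: is_derive_eq; rewrite /GRing.scale/=; ring.
- have h := is_derive_log_rem _ _ (lt1_of _ _ y01 s01).
  by apply: is_derive_eq; rewrite /GRing.scale/=; ring.
- have hx := lt1_of _ _ x01 s01; have hy := lt1_of _ _ y01 s01.
  case/andP: s01 => s0 _.
  have -> : s * x ^+ 2 / (1 - s * x) * y ^+ 2 = s * x ^+ 2 * y ^+ 2 / (1 - s * x) by ring.
  have -> : s * y ^+ 2 / (1 - s * y) * x ^+ 2 = s * x ^+ 2 * y ^+ 2 / (1 - s * y) by ring.
  apply: ler_wpM2l; first by rewrite !mulr_ge0 ?sqr_ge0.
  by rewrite lef_pV2 ?posrE; nra.
Qed.

Lemma log_rem_le x y : 0 <= x -> x <= y -> y < 1 -> log_rem x <= log_rem y.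
Proof.
move=> x0 xy y1; have [y0|y0] := eqVneq y 0.
  by have -> : x = y by lra.
have y20 : 0 < y ^+ 2 by rewrite exprn_gt0 // lt_def y0 (le_trans x0).
have h := log_rem_ratio _ _ x0 xy y1.
have hy : 0 <= log_rem y by apply: log_rem_ge0; lra.
rewrite -(ler_pM2r y20) (le_trans h)// ler_wpM2l// lerXn2r// nnegrE; lra.
Qed.

(** On the ray the denominator [1 - s x] of the derivative is replaced by its value at [s = 1], and
    integrating [s] gives the factor 1/2. This estimate turns the logarithm of [B3] into the
    fraction [B2]. *)
Lemma log_rem_bound x : 0 <= x < 1 -> log_rem x <= x ^+ 2 / (2 * (1 - x)).
Proof.
move=> x01.
have := @le_of_is_derive_le (fun s => log_rem (s * x))
  (fun s => s ^+ 2 * (x ^+ 2 / (2 * (1 - x))))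
  (fun s => s * x ^+ 2 / (1 - s * x))
  (fun s => s * x ^+ 2 / (1 - x)) 1 ler01.
rewrite !mul0r !mul1r log_rem0 !expr2 !mul0r !mul1r lexx; apply => // s s01.
- exact: is_derive_log_rem (lt1_of _ _ x01 s01).
- by apply: is_derive_eq; rewrite /GRing.scale/=; field; lra.
- have hx := lt1_of _ _ x01 s01; case/andP: s01 x01 => s0 s1 /andP[x0 x1].
  apply: ler_wpM2l; first by rewrite mulr_ge0 ?sqr_ge0.
  by rewrite lef_pV2 ?posrE; nra.
Qed.

End real_analysis.
Arguments log_rem {R} x.

(** * Products of complex numbers close to 1 *)

Section complex_product.
Variable R : realType.
Local Notation C := R[i].
Local Notation normc := (@Normc.normc R).
Local Notation Re := (@complex.Re R).
Local Notation Im := (@complex.Im R).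
Local Open Scope complex_scope.
Implicit Types (z w : C) (F G : R -> C).

Lemma normcE2 z : normc z = Num.sqrt (Re z ^+ 2 + Im z ^+ 2).
Proof. by case: z. Qed.

Lemma normc_ge0 z : 0 <= normc z.
Proof. by rewrite normcE2 sqrtr_ge0. Qed.

Lemma normc_real (x : R) : normc x%:C = `|x|.
Proof. by rewrite normcE2 /= expr0n addr0 sqrtr_sqr. Qed.

Lemma dot_le_normc (u v : R) z : u ^+ 2 + v ^+ 2 = 1 ->
  u * Re z + v * Im z <= normc z.
Proof. by move=> uv; rewrite normcE2; exact: dot_cauchy. Qed.

Lemma normc_le_dot z (c : R) : 0 <= c ->
  (forall u v : R, u ^+ 2 + v ^+ 2 = 1 -> u * Re z + v * Im z <= c) ->
  normc z <= c.
Proof. by move=> c0 H; rewrite normcE2; exact: sqrt_le_of_dot. Qed.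

Lemma normc_sum n (f : 'I_n -> C) (g : 'I_n -> R) :
  (forall k, normc (f k) <= g k) -> normc (\sum_k f k) <= \sum_k g k.
Proof.
move=> fg; elim/big_ind2 : _ => //; first by rewrite Normc.normc0.
by move=> z a w b za wb; rewrite (le_trans (le_normcD _ _))// lerD.
Qed.

Lemma Re_sum n (f : 'I_n -> C) : Re (\sum_k f k) = \sum_k Re (f k).
Proof. by apply: (big_morph Re) => // -[a b] [c d]. Qed.

Lemma Im_sum n (f : 'I_n -> C) : Im (\sum_k f k) = \sum_k Im (f k).
Proof. by apply: (big_morph Im) => // -[a b] [c d]. Qed.

Lemma normc_1D_ge w (b : R) : normc w <= b -> 1 - b <= normc (1 + w).
Proof.
move=> wb; have := le_normcD (1 + w) (- w).
by rewrite addrK normcN Normc.normc1; lra.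
Qed.

(** Componentwise, so that the product rule and all later comparisons run on real derivatives. *)
Definition is_cderive (F : R -> C) (s : R) (F' : C) :=
  is_derive s 1 (fun s => Re (F s)) (Re F') /\
  is_derive s 1 (fun s => Im (F s)) (Im F').

Lemma is_cderiveM F G (s : R) (F' G' : C) :
  is_cderive F s F' -> is_cderive G s G' ->
  is_cderive (fun s => F s * G s) s (F' * G s + F s * G').
Proof.
move=> [F1 F2] [G1 G2]; split.
- have -> : (fun s => Re (F s * G s)) =
      (fun s => Re (F s) * Re (G s) - Im (F s) * Im (G s)).
    by apply/funext => x; case: (F x) (G x) => [a b] [c d].
  apply: is_derive_eq; rewrite /GRing.scale/=.
  by case: (F s) (G s) F' G' {F1 F2 G1 G2} => [a b] [c d] [e f] [g h] /=; ring.
- have -> : (fun s => Im (F s * G s)) =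
      (fun s => Re (F s) * Im (G s) + Im (F s) * Re (G s)).
    by apply/funext => x; case: (F x) (G x) => [a b] [c d].
  apply: is_derive_eq; rewrite /GRing.scale/=.
  by case: (F s) (G s) F' G' {F1 F2 G1 G2} => [a b] [c d] [e f] [g h] /=; ring.
Qed.

Lemma is_cderive_affine w (s : R) : is_cderive (fun s => 1 + s%:C * w) s w.
Proof.
case: w => a b; split => /=;
  by apply: is_derive_eq; rewrite /GRing.scale/=; ring.
Qed.

Lemma is_cderive_expR (c s : R) :
  is_cderive (fun s => (expR (s * c))%:C) s (expR (s * c) * c)%:C.
Proof.
split => /=; last exact: is_derive_cst.
have hg : is_derive s 1 (fun s : R => s * c) c.
  by apply: is_derive_eq; rewrite /GRing.scale/=; ring.
exact: (@is_derive1_comp R expR (fun s => s * c) s _ _ (is_derive_expR _) hg).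
Qed.

Lemma is_cderive_prod (I : Type) (r : seq I) (w : I -> C) (s : R) :
  (forall k, 1 + s%:C * w k != 0) ->
  is_cderive (fun s => \prod_(k <- r) (1 + s%:C * w k)) s
    (\prod_(k <- r) (1 + s%:C * w k) * \sum_(k <- r) (w k / (1 + s%:C * w k))).
Proof.
move=> w0; elim: r => [|i r IH].
  rewrite !big_nil mul1r.
  have -> : (fun s => \prod_(k <- [::]) (1 + s%:C * w k)) = fun=> 1 : C.
    by apply/funext => x; rewrite big_nil.
  by split; exact: is_derive_cst.
have -> : (fun s => \prod_(k <- i :: r) (1 + s%:C * w k)) =
    fun s => (1 + s%:C * w i) * \prod_(k <- r) (1 + s%:C * w k).
  by apply/funext => x; rewrite big_cons.
have := is_cderiveM _ _ _ _ _ (is_cderive_affine (w i) s) IH.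
rewrite !big_cons; set p := \prod_(k <- r) _; set t := \sum_(k <- r) _.
by congr (is_cderive _ _ _); have := w0 i; set x := w i => x0; field.
Qed.

(* [F' = F G] with [normc (G s) <= psi' s], hence [normc (F s) <= exp (psi s)]
   and then [normc (F 1 - F 0) <= exp (psi 1) - 1]; no complex logarithm is needed. *)
Lemma normc_prod_sub_exp_le n (w : 'I_n -> C) (a : 'I_n -> R) :
  (forall k, normc (w k) <= a k) -> (forall k, a k < 1) ->
  normc (\prod_k (1 + w k) - (expR (- \sum_k a k))%:C) <=
  (expR (normc (\sum_k (w k + (a k)%:C)) + \sum_k log_rem (a k)) - 1)
  * expR (- \sum_k a k).
Proof.
move=> wa a1; set T := \sum_k a k; set D := \sum_k (w k + _).
have a0 k : 0 <= a k by rewrite (le_trans (normc_ge0 _) (wa k)).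
have a01 k : 0 <= a k < 1 by rewrite a0 a1.
have sa1 (s : R) k : 0 <= s <= 1 -> s * a k < 1.
  by move=> /andP[s0 s1]; have := a0 k; have := a1 k; nra.
have swa (s : R) k : 0 <= s -> normc (s%:C * w k) <= s * a k.
  by move=> s0; rewrite Normc.normcM normc_real ger0_norm// ler_wpM2l.
have den (s : R) k : 0 <= s <= 1 -> 1 - s * a k <= normc (1 + s%:C * w k).
  by move=> /andP[s0 s1]; apply: normc_1D_ge; exact: swa.
have den0 (s : R) k : 0 <= s <= 1 -> 1 + s%:C * w k != 0.
  move=> s01; apply/eqP => h; have := den s k s01; rewrite h Normc.normc0.
  by have := sa1 s k s01; lra.
(* [F] deforms 1 into [exp T] times the product. Since [w / (1 + s w) = w - s w^2 / (1 + s w)], its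
   logarithmic derivative is [G], the terms free of [s] collecting into [D]. The majorant [dpsi] of
   [|G|] comes from [|1 + s w_k| >= 1 - s a_k]. *)
pose F (s : R) := (expR (s * T))%:C * \prod_k (1 + s%:C * w k).
pose G (s : R) := D - \sum_k (s%:C * w k ^+ 2 / (1 + s%:C * w k)).
pose psi (s : R) := s * normc D + \sum_k log_rem (s * a k).
pose dpsi (s : R) := normc D + \sum_k (s * a k ^+ 2 / (1 - s * a k)).
have dF (s : R) : 0 <= s <= 1 -> is_cderive F s (F s * G s).
  move=> s01.
  have := is_cderiveM _ _ _ _ _ (is_cderive_expR T s)
    (is_cderive_prod _ (index_enum 'I_n) w s (fun k => den0 s k s01)).
  congr (is_cderive _ _ _); rewrite /F rmorphM/= -!mulrA -mulrDr; congr (_ * _).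
  rewrite [T%:C * _]mulrC -mulrDr; congr (_ * _).
  rewrite /G /D /T rmorph_sum/= -!big_split/= -sumrN -big_split/=.
  apply: eq_bigr => k _; have := den0 s k s01.
  by set x := w k => x0; field.
have dpsiP (s : R) : 0 <= s <= 1 -> is_derive s 1 psi (dpsi s).
  move=> s01; rewrite /psi /dpsi.
  have h1 : is_derive s 1 (fun s : R => s * normc D) (normc D).
    by apply: is_derive_eq; rewrite /GRing.scale/=; ring.
  have h2 : is_derive s 1 (\sum_k (fun s : R => log_rem (s * a k)))
      (\sum_k (s * a k ^+ 2 / (1 - s * a k))).
    by apply: is_derive_sum => k; apply: is_derive_log_rem; exact: sa1.
  have := is_deriveD h1 h2; congr (is_derive _ _ _ _).
  by apply/funext => x; rewrite !fctE; congr (_ + _); rewrite fct_sumE.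
have GP (s : R) : 0 <= s <= 1 -> normc (G s) <= dpsi s.
  move=> s01; rewrite (le_trans (le_normcD _ _))// lerD2l normcN.
  apply: normc_sum => k; rewrite Normc.normcM Normc.normcV Normc.normcM.
  have [s0 s1] := andP s01; rewrite normc_real ger0_norm// !expr2 Normc.normcM.
  have := den s k s01; have := sa1 s k s01 => h1 h2.
  rewrite ler_pM ?mulr_ge0 ?invr_ge0 ?normc_ge0//.
    by rewrite ler_wpM2l// ler_pM ?normc_ge0.
  by rewrite lef_pV2 ?posrE; lra.
(* The squared modulus is differentiable everywhere and [N' = 2 N Re G], so [N exp (-2 psi)] does
   not increase from its value 1 at 0. *)
pose N (s : R) := Re (F s) ^+ 2 + Im (F s) ^+ 2.
have F0 : F 0 = 1.
  rewrite /F mul0r expR0 mul1r big1// => k _.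
  by rewrite mul0r addr0.
have N0 : N 0 = 1 by rewrite /N F0 /= expr1n expr0n addr0.
have psi0 : psi 0 = 0.
  by rewrite /psi mul0r add0r big1// => k _; rewrite mul0r log_rem0.
have dpsiE (s : R) : 0 <= s <= 1 ->
    is_derive s 1 (fun s : R => expR (psi s)) (expR (psi s) * dpsi s).
  move=> s01; exact: (@is_derive1_comp R expR psi s _ _ (is_derive_expR _) (dpsiP s s01)).
have NP (s : R) : 0 <= s <= 1 -> normc (F s) <= expR (psi s).
  move=> /andP[s0 s1].
  have : N s * expR (psi s) ^- 2 <= 1.
    have := @le_of_is_derive_le R (fun s : R => N s * expR (psi s) ^- 2) (fun=> 1)
      (fun s : R => 2 * N s * (Re (G s) - dpsi s) * expR (psi s) ^- 2) (fun=> 0) s s0.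
    rewrite psi0 N0 expR0 expr1n invr1 mulr1 lexx.
    apply => // x /andP[x0 xs]; have x01 : 0 <= x <= 1 by lra.
      have [hR hI] := dF x x01.
      have hp := dpsiE x x01.
      have e0 := expR_gt0 (psi x).
      have hV : is_derive x 1 (fun s : R => (expR (psi s) ^+ 2)^-1)
          (- 2 * dpsi x * expR (psi x) ^- 2).
        have hX : is_derive x 1 (fun s : R => expR (psi s) ^+ 2)
            (2 * expR (psi x) * (expR (psi x) * dpsi x)).
          by apply: is_derive_eq; rewrite /GRing.scale/=; ring.
        apply: (is_derive_eq (is_deriveV _ hX)).
          by rewrite expf_neq0// gt_eqF.
        by rewrite /GRing.scale/=; field; rewrite gt_eqF.
      have hN : is_derive x 1 N (2 * N x * Re (G x)).
        apply: is_derive_eq; rewrite /N /GRing.scale/=.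
        by case: (F x) (G x) => [p q] [r t] /=; ring.
      by apply: is_derive_eq; rewrite /GRing.scale/=; ring.
    have hd : Re (G x) <= dpsi x.
      rewrite (le_trans _ (GP x x01))//.
      have := dot_le_normc 1 0 (G x); rewrite !expr2; lra.
    rewrite pmulr_lle0 ?invr_gt0 ?exprn_gt0 ?expR_gt0//.
    by rewrite mulr_ge0_le0 ?subr_le0// mulr_ge0// /N addr_ge0 ?sqr_ge0.
  rewrite ler_pdivrMr ?exprn_gt0 ?expR_gt0// mul1r => h.
  rewrite normcE2 -[leRHS]ger0_norm ?expR_ge0// -sqrtr_sqr ler_sqrt ?exprn_ge0 ?expR_ge0//.
have main : normc (F 1 - 1) <= expR (psi 1) - 1.
  (* In a fixed direction the derivative of [F] is at most [|F| |G|], hence at most [exp psi] times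
     [dpsi], the derivative of [exp psi]. *)
  have key (u v : R) : u ^+ 2 + v ^+ 2 = 1 ->
      u * Re (F 1) + v * Im (F 1) - u <= expR (psi 1) - 1.
    move=> uv.
    apply: (@le_of_is_derive_le R (fun s : R => u * Re (F s) + v * Im (F s) - u)
      (fun s : R => expR (psi s) - 1)
      (fun s : R => u * Re (F s * G s) + v * Im (F s * G s))
      (fun s : R => expR (psi s) * dpsi s)) => // [x x01|x x01|x x01|].
    - have [hR hI] := dF x x01.
      by apply: is_derive_eq; rewrite /GRing.scale/=; ring.
    - by have h := dpsiE x x01; apply: is_derive_eq; rewrite subr0.
    - rewrite (le_trans (dot_le_normc _ _ _ uv))// Normc.normcM.
      by rewrite ler_pM ?normc_ge0 ?NP ?GP.
    - by rewrite F0 psi0 expR0 /=; lra.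
  apply: normc_le_dot => [|u v uv].
    by have := key 1 0; have := key (-1) 0; rewrite !expr2; lra.
  have := key u v uv; case: (F 1) => p q /=; lra.
have psi1 : psi 1 = normc D + \sum_k log_rem (a k).
  by rewrite /psi mul1r; congr (_ + _); apply: eq_bigr => k _; rewrite mul1r.
rewrite -psi1.
have -> : \prod_k (1 + w k) - (expR (- T))%:C = (F 1 - 1) * (expR (- T))%:C.
  rewrite /F mul1r mulrBl mul1r mulrAC -rmorphM/= -expRD addrN expR0 mul1r.
  by congr (_ - _); apply: eq_bigr => k _; rewrite mul1r.
by rewrite Normc.normcM normc_real ger0_norm ?expR_ge0// ler_wpM2r ?expR_ge0.
Qed.

End complex_product.

(** * Truncated moments *)

Section quadratic_growth.
Variable R : realType.
Implicit Types (h f : R -> R) (s : seq (R * (R -> R))) (x z : R).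

(** The test functions that a finite second moment makes integrable. *)
Definition quad_growth h :=
  measurable_fun setT h /\ exists c, forall x, `|h x| <= c * (1 + x ^+ 2).

Definition comb s x := foldr (fun p r => p.1 * p.2 x + r) 0 s.

Fixpoint all_quad s : Prop :=
  if s is p :: s' then quad_growth p.2 /\ all_quad s' else True.

Definition Ecomb (E : (R -> R) -> R) s := foldr (fun p r => p.1 * E p.2 + r) 0 s.

(* Positivity on all finite combinations replaces linearity plus monotonicity:
   every moment inequality below is one pointwise inequality [0 <= comb s x]. *)
Definition pos_linear (E : (R -> R) -> R) :=
  forall s, all_quad s -> (forall x, 0 <= comb s x) -> 0 <= Ecomb E s.

Lemma quad_growth_comb s : all_quad s -> quad_growth (comb s).
Proof.
elim: s => [_|[a h] s IH /= [[mh [c hc]] /IH[ms [c' hc']]]].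
  by split; [exact: measurable_cst|exists 0 => x; rewrite normr0 mul0r].
split; first by apply: measurable_funD => //; exact: measurable_funM.
exists (`|a| * c + c') => x; rewrite mulrDl (le_trans (ler_normD _ _))// lerD//; last exact: hc'.
by rewrite normrM -mulrA ler_wpM2l.
Qed.

Lemma quad_growth_cst c : quad_growth (fun=> c).
Proof.
split; first exact: measurable_cst.
exists `|c| => x; rewrite mulrDr mulr1 lerDl mulr_ge0 ?sqr_ge0//.
Qed.

Lemma quad_growth_sqr : quad_growth (fun x => x ^+ 2).
Proof.
split; first exact: exprn_measurable.
by exists 1 => x; rewrite mul1r ger0_norm ?sqr_ge0// lerDr.
Qed.

Lemma quad_growth_id : quad_growth id.
Proof.
split; first exact: measurable_id.
exists 1 => x; rewrite mul1r -[x ^+ 2]real_normK ?num_real//.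
by have := sqr_ge0 (`|x| - 1); have := sqr_ge0 `|x|; lra.
Qed.

Lemma quad_growth_bounded h c : measurable_fun setT h ->
  (forall x, `|h x| <= c) -> quad_growth h.
Proof.
move=> mh hc; split => //; exists `|c| => x.
rewrite (le_trans (hc x))// (le_trans (ler_norm _))// mulrDr mulr1 lerDl.
by rewrite mulr_ge0 ?sqr_ge0.
Qed.

Lemma quad_growth_cos (t : R) : quad_growth (fun x => cos (t * x)).
Proof.
apply: (@quad_growth_bounded _ 1) => [|x]; last by rewrite ler_norml cos_geN1 cos_le1.
apply: measurableT_comp; last exact: measurable_funM.
by apply: continuous_measurable_fun; exact: continuous_cos.
Qed.

Lemma quad_growth_sin (t : R) : quad_growth (fun x => sin (t * x)).
Proof.
apply: (@quad_growth_bounded _ 1) => [|x]; last by rewrite ler_norml sin_geN1 sin_le1.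
apply: measurableT_comp; last exact: measurable_funM.
by apply: continuous_measurable_fun; exact: continuous_sin.
Qed.

Definition tail2 z x : R := x ^+ 2 * (if z <= `|x| then 1 else 0).
Definition trunc3 z x : R := x ^+ 3 * (if `|x| < z then 1 else 0).
(** The fourth power below the cut, continued above it by [z^2 x^2]: growth stays quadratic, and for
    [z > 0] the derivative in [z] is [2 z tail2 z] away from [z = |x|]. *)
Definition trunc4 z x : R := x ^+ 2 * Num.min (x ^+ 2) (z ^+ 2).

Lemma quad_growth_tail2 z : quad_growth (tail2 z).
Proof.
split.
  apply: measurable_funM; first exact: exprn_measurable.
  apply: measurable_fun_ifT => //; exact: measurable_fun_ler.
exists 1 => x; rewrite /tail2 mul1r normrM ger0_norm ?sqr_ge0//.
by have := sqr_ge0 x; case: ifP => _; rewrite ?normr1 ?normr0; lra.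
Qed.

Lemma quad_growth_trunc3 z : quad_growth (trunc3 z).
Proof.
split.
  apply: measurable_funM; first exact: exprn_measurable.
  apply: measurable_fun_ifT => //; exact: measurable_fun_ltr.
exists `|z| => x; rewrite /trunc3 normrM normrX.
have x2 := sqr_ge0 `|x|; have z0 := normr_ge0 z; have x0 := normr_ge0 x.
rewrite -[x ^+ 2]real_normK ?num_real//.
case: ifP => xz; rewrite ?normr1 ?normr0 ?mulr0 ?mulr1; last by rewrite mulr_ge0; lra.
rewrite exprS (@le_trans _ _ (`|z| * `|x| ^+ 2))//.
  by rewrite ler_wpM2r// (le_trans (ltW xz))// ler_norm.
by rewrite ler_wpM2l//; lra.
Qed.

Lemma quad_growth_trunc4 z : quad_growth (trunc4 z).
Proof.
split.
  apply: measurable_funM; first exact: exprn_measurable.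
  by apply: measurable_minr => //; exact: exprn_measurable.
exists (z ^+ 2) => x; have x2 := sqr_ge0 x; have z2 := sqr_ge0 z.
rewrite /trunc4 ger0_norm; last by rewrite mulr_ge0// le_min x2.
rewrite mulrC (@le_trans _ _ (z ^+ 2 * x ^+ 2))//.
  by rewrite ler_wpM2r// ge_min lexx orbT.
by rewrite ler_wpM2l//; lra.
Qed.

Ltac quad_growth_tac := cbn [all_quad fst snd];
  repeat match goal with
  | |- quad_growth _ => first
      [ exact: quad_growth_cst | exact: quad_growth_id | exact: quad_growth_sqr
      | exact: quad_growth_cos | exact: quad_growth_sin | exact: quad_growth_tail2
      | exact: quad_growth_trunc3 | exact: quad_growth_trunc4 ]
  | |- _ /\ _ => split
  | |- True => exact I
  end.

Section pos_linear_theory.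
Variable E : (R -> R) -> R.
Hypothesis posE : pos_linear E.
Local Notation sg := (E (fun x => x ^+ 2)).

Lemma sqr_moment_ge0 : 0 <= sg.
Proof.
have := posE [:: (1, fun x => x ^+ 2)]; rewrite /comb /Ecomb/= addr0 mul1r; apply.
  by quad_growth_tac.
by move=> x; rewrite mul1r addr0 sqr_ge0.
Qed.

Lemma tail2_ge0 z : 0 <= E (tail2 z).
Proof.
have := posE [:: (1, tail2 z)]; rewrite /comb /Ecomb/= addr0 mul1r; apply.
  by quad_growth_tac.
move=> x; rewrite mul1r addr0 /tail2; case: ifP; rewrite ?mulr1 ?mulr0//.
by rewrite sqr_ge0.
Qed.

(** Lowering the cut from [y] to [y q] changes the minimum only where [|x| >= y q], and there by at
    most [y^2 - (y q)^2]. *)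
Lemma trunc4_step y q : 0 < y -> 0 < q < 1 ->
  E (trunc4 y) <= E (trunc4 (y * q)) + y ^+ 2 * (1 - q ^+ 2) * E (tail2 (y * q)).
Proof.
move=> y0 /andP[q0 q1].
rewrite -subr_ge0.
have := posE [:: (-1, trunc4 y); (1, trunc4 (y * q));
  (y ^+ 2 * (1 - q ^+ 2), tail2 (y * q))].
rewrite /comb /Ecomb/= => h.
rewrite [X in 0 <= X](_ : _ = -1 * E (trunc4 y) + (1 * E (trunc4 (y * q)) +
   (y ^+ 2 * (1 - q ^+ 2) * E (tail2 (y * q)) + 0))); last by ring.
apply: h => [|x].
  by quad_growth_tac.
rewrite /trunc4 /tail2.
set A := Num.min (x ^+ 2) (y ^+ 2); set B := Num.min _ _; set C := (if _ then _ else _).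
suff : A <= B + y ^+ 2 * (1 - q ^+ 2) * C.
  by move: A B C => A B C /(ler_wpM2l (sqr_ge0 x)); lra.
rewrite /A /B /C {A B C}.
have yq0 : 0 < y * q by rewrite mulr_gt0.
have [yx|yx] := leP (y * q) `|x|.
  have : (y * q) ^+ 2 <= x ^+ 2.
    by rewrite -[x ^+ 2]real_normK ?num_real// lerXn2r ?nnegrE ?(ltW yq0).
  move=> /min_idPr ->; rewrite ge_min; apply/orP; right => /=; lra.
have : x ^+ 2 <= (y * q) ^+ 2.
  by rewrite -[x ^+ 2]real_normK ?num_real// lerXn2r ?nnegrE ?(ltW yq0)// ltW.
by move=> /min_idPl ->; rewrite ge_min mulr0 addr0 lexx.
Qed.

Lemma trunc4_le_sqr y : E (trunc4 y) <= y ^+ 2 * sg.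
Proof.
rewrite -subr_ge0.
have := posE [:: (-1, trunc4 y); (y ^+ 2, fun x => x ^+ 2)].
rewrite /comb /Ecomb/= => h.
rewrite [X in 0 <= X](_ : _ = -1 * E (trunc4 y) + (y ^+ 2 * sg + 0)); last by ring.
apply: h => [|x].
  by quad_growth_tac.
rewrite /trunc4.
have : Num.min (x ^+ 2) (y ^+ 2) <= y ^+ 2 by rewrite ge_min lexx orbT.
by have := sqr_ge0 x; nra.
Qed.

(** Step [N] costs [(z q^N)^2 (1 - q^2)] times a tail at [z q^(N+1)], hence at most
    [z S (1 + 1/q) q^N (1 - q)], and these telescope. The factor [1 + 1/q] tends to 2 as [q] tends
    to 1. *)
Lemma trunc4_geometric z q S N : 0 < z -> 0 < q < 1 ->
  (forall y, 0 < y -> y <= z -> y * E (tail2 y) <= S) ->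
  E (trunc4 z) <= E (trunc4 (z * q ^+ N)) + z * S * (1 + q^-1) * (1 - q ^+ N).
Proof.
move=> z0 q01 hS; have /andP[q0 q1] := q01.
elim: N => [|N IH]; first by rewrite expr0 mulr1 subrr mulr0 addr0.
apply: (le_trans IH).
have qN0 : 0 < q ^+ N by rewrite exprn_gt0.
have qN1 : q ^+ N <= 1 by rewrite exprn_ile1// ltW.
have zq0 : 0 < z * q ^+ N by rewrite mulr_gt0.
have zq1 : z * q ^+ N * q <= z by rewrite -mulrA ger_pMr// mulr_ile1// ltW.
have := trunc4_step _ _ zq0 q01; rewrite (exprSr q N) mulrA => h.
have hz := hS _ (mulr_gt0 zq0 q0) zq1.
suff : (z * q ^+ N) ^+ 2 * (1 - q ^+ 2) * E (tail2 (z * q ^+ N * q)) <=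
    z * S * (1 + q^-1) * (q ^+ N * (1 - q)) by lra.
have -> : (z * q ^+ N) ^+ 2 * (1 - q ^+ 2) * E (tail2 (z * q ^+ N * q)) =
    (z * (1 + q^-1) * (q ^+ N * (1 - q))) * (z * q ^+ N * q * E (tail2 (z * q ^+ N * q))).
  by field; rewrite gt_eqF.
have -> : z * S * (1 + q^-1) * (q ^+ N * (1 - q)) =
  (z * (1 + q^-1) * (q ^+ N * (1 - q))) * S by ring.
apply: ler_wpM2l => //; have q10 : 0 < q^-1 by rewrite invr_gt0.
by rewrite mulr_ge0// mulr_ge0//; lra.
Qed.

Lemma le_geometric_bound (a b c q : R) : 0 < q < 1 ->
  (forall N, a <= b + c * q ^+ N) -> a <= b.
Proof.
move=> /andP[q0 q1] h.
have cv : (fun N => b + c * q ^+ N) @ \oo --> b.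
  rewrite -[X in _ --> X]addr0 -[X in _ + X](mulr0 c).
  apply: cvgD; first exact: cvg_cst.
  by apply: cvgM; [exact: cvg_cst|apply: cvg_expr; rewrite gtr0_norm].
by apply: (cvgr_to_ge cv); exact: nearW.
Qed.

(* This is [E X^2 min(X^2, z^2) = \int_0^z 2 y E X^2 1(|X| >= y) dy] with the
   integral replaced by Riemann sums on the partitions [z q^i], [q] tending to 1. *)
Lemma trunc4_le z S : 0 < z ->
  (forall y, 0 < y -> y <= z -> y * E (tail2 y) <= S) ->
  E (trunc4 z) <= 2 * z * S.
Proof.
move=> z0 hS.
have S0 : 0 <= S.
  by rewrite (le_trans _ (hS z z0 (lexx z)))// mulr_ge0 ?tail2_ge0// ltW.
have hq q : 0 < q < 1 -> E (trunc4 z) <= z * S * (1 + q^-1).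
  move=> q01; have /andP[q0 q1] := q01.
  apply: (@le_geometric_bound _ _ (z ^+ 2 * sg) q) => // N.
  have h := trunc4_geometric z q S N z0 q01 hS.
  have h2 := trunc4_le_sqr (z * q ^+ N).
  have qN0 : 0 < q ^+ N by rewrite exprn_gt0.
  have qN1 : q ^+ N <= 1 by rewrite exprn_ile1// ltW.
  have h3 : (z * q ^+ N) ^+ 2 * sg <= z ^+ 2 * sg * q ^+ N.
    have -> : (z * q ^+ N) ^+ 2 * sg = z ^+ 2 * sg * (q ^+ N * q ^+ N) by ring.
    rewrite ler_wpM2l ?mulr_ge0 ?sqr_ge0 ?sqr_moment_ge0//; nra.
  have h4 : 0 <= z * S * (1 + q^-1) * q ^+ N.
    have q10 : 0 < q^-1 by rewrite invr_gt0.
    by rewrite !mulr_ge0 ?(ltW qN0) ?(ltW z0)//; lra.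
  by lra.
have [S00|S00] := eqVneq S 0.
  by have := hq 2^-1; rewrite S00 !mulr0 mul0r; apply; lra.
have zS : 0 < z * S by rewrite mulr_gt0// lt_def S00.
apply/ler_addgt0Pr => e e0.
have d0 : 0 < e / (z * S) by rewrite divr_gt0.
(* [q] is chosen with [1/q = 1 + e / (z S)], which makes the bound [z S (1 + 1/q)] equal to
   [2 z S + e]; the division is the reason for treating [S = 0] apart. *)
have := hq (1 + e / (z * S))^-1; rewrite invrK.
have -> : z * S * (1 + (1 + e / (z * S))) = 2 * z * S + e.
  by field; rewrite S00 gt_eqF.
by apply; rewrite invr_gt0 invf_lt1; lra.
Qed.

Lemma sqr_moment_split z : E (fun=> 1) = 1 -> sg <= z ^+ 2 + E (tail2 z).
Proof.
move=> E1; rewrite -subr_ge0.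
have := posE [:: (-1, fun x => x ^+ 2); (z ^+ 2, fun=> 1); (1, tail2 z)].
rewrite /comb /Ecomb/= E1 => h.
rewrite [X in 0 <= X](_ : _ = -1 * sg + (z ^+ 2 * 1 + (1 * E (tail2 z) + 0)));
  last by ring.
apply: h => [|x].
  by quad_growth_tac.
rewrite /tail2; have [zx|xz] := leP z `|x|; first by have := sqr_ge0 z; lra.
suff : x ^+ 2 <= z ^+ 2 by lra.
rewrite -[x ^+ 2]real_normK ?num_real// lerXn2r ?nnegrE//.
  by rewrite (le_trans _ (ltW xz)).
exact: ltW.
Qed.

(* With [a = E X^2 1(|X| < z)]: [a^2 <= E X^4 1(|X| < z)] by Cauchy-Schwarz and
   [a E X^2 1(|X| >= z) <= z^2 E X^2 1(|X| >= z)]; the two right-hand sides add up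
   to [E X^2 min(X^2, z^2)]. *)
Lemma sqr_moment_sqr_le z : 0 < z -> E (fun=> 1) = 1 ->
  sg * sg <= sg * E (tail2 z) + E (trunc4 z).
Proof.
move=> z0 E1; have az := sqr_moment_split z E1.
set b := E (tail2 z) in az *; set a := sg - b.
(* The coefficients make the integrand [(x^2 - a)^2] below the cut and [a^2] above it. Its
   expectation gives [a^2 + z^2 b <= E (trunc4 z)], and [a <= z^2] bounds the left side below by
   [a (a + b)]. *)
have := posE [:: (1, trunc4 z); (- (2 * a), fun x => x ^+ 2);
  (2 * a - z ^+ 2, tail2 z); (a ^+ 2, fun=> 1)].
rewrite /comb /Ecomb/= E1 -/b => h.
have b0 : 0 <= b := tail2_ge0 z.
suff : 0 <= 1 * E (trunc4 z) + (- (2 * a) * sg + ((2 * a - z ^+ 2) * b + (a ^+ 2 * 1 + 0))).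
  by have : a <= z ^+ 2 by [rewrite /a; lra]; rewrite /a; nra.
apply: h => [|x].
  by quad_growth_tac.
rewrite /trunc4 /tail2; have [zx|xz] := leP z `|x|.
  have : z ^+ 2 <= x ^+ 2.
    by rewrite -[x ^+ 2]real_normK ?num_real// lerXn2r ?nnegrE ?(ltW z0).
  by move=> /min_idPr ->; have := sqr_ge0 a; lra.
have : x ^+ 2 <= z ^+ 2.
  by rewrite -[x ^+ 2]real_normK ?num_real// lerXn2r ?nnegrE ?(ltW z0)// ltW.
by move=> /min_idPl ->; have := sqr_ge0 (x ^+ 2 - a); lra.
Qed.

(** Below [z] the fourth-order Taylor bound applies, with the cubic term kept as [trunc3]; above it
    [kappa_dot] does. The term [t^4 / 24] times [trunc4 z] runs over the whole line and adds
    [z^2 t^4 x^2 / 24] above the cut, which the coefficient of [tail2 z] subtracts again. [E 1] and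
    [E id] stay symbolic because the lemma is applied to the sum of [n] expectations, where
    [E 1 = n]. *)
Lemma charfun_dot_le (u v t z S : R) : u ^+ 2 + v ^+ 2 = 1 -> 0 < z ->
  (forall y, 0 < y -> y <= z -> y * E (tail2 y) <= S) ->
  u * (E (fun x => cos (t * x)) - E (fun=> 1) + sg * t ^+ 2 / 2) +
  v * (E (fun x => sin (t * x)) - t * E id) <=
  t ^+ 2 * (`|t| / 6 * `|E (trunc3 z)| + (kappa R - z ^+ 2 * t ^+ 2 / 24) * E (tail2 z)
            + t ^+ 2 / 12 * (z * S)).
Proof.
move=> uv z0 hS; have hV := trunc4_le z S z0 hS.
have := posE [:: (- u, fun x => cos (t * x)); (u, fun=> 1); (- (u * t ^+ 2 / 2), fun x => x ^+ 2);
  (- v, fun x => sin (t * x)); (v * t, id); (- (v * t ^+ 3 / 6), trunc3 z);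
  (t ^+ 2 * (kappa R - z ^+ 2 * t ^+ 2 / 24), tail2 z); (t ^+ 4 / 24, trunc4 z)].
rewrite /comb /Ecomb/= => h.
have hM : - (v * t ^+ 3 / 6) * E (trunc3 z) <= t ^+ 2 * (`|t| / 6 * `|E (trunc3 z)|).
  apply: (le_trans (ler_norm _)).
  have -> : `|- (v * t ^+ 3 / 6) * E (trunc3 z)| =
      `|v| * (t ^+ 2 * (`|t| / 6 * `|E (trunc3 z)|)).
    have t3 : `|t ^+ 3| = t ^+ 2 * `|t| by rewrite normrX exprSr real_normK ?num_real.
    have i6 : `|6^-1 : R| = 6^-1 by rewrite ger0_norm.
    by move: (t ^+ 3) t3 => y t3; rewrite !normrM normrN !normrM t3 i6; ring.
  apply: ler_piMl; first by rewrite mulr_ge0 ?sqr_ge0// mulr_ge0// divr_ge0.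
  by have := sqr_ge0 u; rewrite ler_norml; nra.
have {}hV : t ^+ 4 / 24 * E (trunc4 z) <= t ^+ 4 / 24 * (2 * z * S).
  by rewrite ler_wpM2l// divr_ge0// (_ : t ^+ 4 = (t ^+ 2) ^+ 2) ?sqr_ge0// -exprM.
suff : 0 <= - u * E (fun x => cos (t * x)) + (u * E (fun=> 1) + (- (u * t ^+ 2 / 2) * sg +
  (- v * E (fun x => sin (t * x)) + (v * t * E id + (- (v * t ^+ 3 / 6) * E (trunc3 z) +
  (t ^+ 2 * (kappa R - z ^+ 2 * t ^+ 2 / 24) * E (tail2 z) + (t ^+ 4 / 24 * E (trunc4 z) + 0))))))).
  by lra.
apply: h => [|x].
  by quad_growth_tac.
rewrite /trunc3 /trunc4 /tail2; have [zx|xz] := leP z `|x|.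
  have : z ^+ 2 <= x ^+ 2.
    by rewrite -[x ^+ 2]real_normK ?num_real// lerXn2r ?nnegrE ?(ltW z0).
  by move=> /min_idPr ->; have := kappa_dot _ _ _ (t * x) uv; lra.
have : x ^+ 2 <= z ^+ 2.
  by rewrite -[x ^+ 2]real_normK ?num_real// lerXn2r ?nnegrE ?(ltW z0)// ltW.
by move=> /min_idPl ->; have := taylor4_dot _ _ _ (t * x) uv; lra.
Qed.

(** Supplies [|w_k| <= a_k] for the product estimate, once [E 1 = 1] and [E id = 0]. *)
Lemma charfun_sub1_dot_le (u v t : R) : u ^+ 2 + v ^+ 2 = 1 ->
  u * (E (fun x => cos (t * x)) - E (fun=> 1)) +
  v * (E (fun x => sin (t * x)) - t * E id) <= sg * t ^+ 2 / 2.
Proof.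
move=> uv.
have := posE [:: (- u, fun x => cos (t * x)); (u, fun=> 1); (t ^+ 2 / 2, fun x => x ^+ 2);
  (- v, fun x => sin (t * x)); (v * t, id)].
rewrite /comb /Ecomb/= => h.
suff : 0 <= - u * E (fun x => cos (t * x)) + (u * E (fun=> 1) + (t ^+ 2 / 2 * sg +
  (- v * E (fun x => sin (t * x)) + (v * t * E id + 0)))) by lra.
apply: h => [|x].
  by quad_growth_tac.
by have := taylor2_dot_real _ _ _ (t * x) uv; lra.
Qed.

End pos_linear_theory.

(** Makes the moment lemmas available for the sum over [k], whose [tail2] and [trunc3] moments are
    [L_n] and [M_n]. *)
Lemma pos_linear_sum n (E : 'I_n -> (R -> R) -> R) :
  (forall k, pos_linear (E k)) -> pos_linear (fun h => \sum_k E k h).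
Proof.
move=> posE s qs s0.
have -> : Ecomb (fun h => \sum_k E k h) s = \sum_k Ecomb (E k) s.
  elim: s {qs s0} => [|p s IH]; first by rewrite /Ecomb/= big1.
  have EcombS E' : Ecomb E' (p :: s) = p.1 * E' p.2 + Ecomb E' s by [].
  by rewrite EcombS IH mulr_sumr -big_split.
by apply: sumr_ge0 => k _; exact: posE.
Qed.

End quadratic_growth.

(** * Expectation as a positive functional on functions of quadratic growth *)

Section moments.
Context {R : realType} {d : measure_display} {T : measurableType d}.
Variables (P : probability T R) (X : {RV P >-> R}).
Hypothesis X2 : P.-integrable setT (EFin \o (fun w => X w ^+ 2)).

(** Convertible with the expectations inside [charfun], [L_n] and [M_n], so these unfold to it
    without rewriting. *)
Definition mom (h : R -> R) : R := fine ('E_P[fun w => h (X w)]).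

Lemma momE h : mom h = \int[P]_w h (X w).
Proof. by rewrite /mom unlock. Qed.

Lemma integrable_quad_growth h : quad_growth R h ->
  P.-integrable setT (EFin \o (fun w => h (X w))).
Proof.
move=> [mh [c hc]].
have i1 : P.-integrable setT (EFin \o (fun w => c * (1 + X w ^+ 2))).
  have ic : P.-integrable setT (EFin \o cst (1 : R)).
    exact: finite_measure_integrable_cst.
  have := integrableZl measurableT c (integrableD measurableT ic X2).
  by apply: eq_integrable.
apply: (le_integrable _ _ _ i1) => //.
  by apply/measurable_EFinP; exact: measurableT_comp.
by move=> w _ /=; rewrite lee_fin (le_trans (hc _))// ler_norm.
Qed.

Lemma mom_cst c : mom (fun=> c) = c.
Proof. by rewrite /mom (expectation_cst P c). Qed.

Lemma pos_linear_mom : pos_linear R mom.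
Proof.
move=> s qs s0.
suff -> : Ecomb R mom s = mom (comb R s).
  by rewrite momE Rintegral_ge0.
elim: s {s0} qs => [_|[a h] s IH /= [qh qs]]; first by rewrite mom_cst.
rewrite /Ecomb/= -/(Ecomb R mom s) IH// !momE -RintegralZl//; last first.
  exact: integrable_quad_growth.
rewrite -RintegralD//.
  by have := integrableZl measurableT a (integrable_quad_growth h qh); apply: eq_integrable.
exact: integrable_quad_growth (quad_growth_comb _ _ qs).
Qed.

End moments.

(** * The parameters of the bounds *)

Section parameters.
Variable R : realType.
Implicit Types (e : \bar R) (g L t x u z : R).

Lemma powR_frac (a : R) (k m : nat) :
  a `^ (k%:R / m%:R) = (a `^ (m%:R^-1)) ^+ k.
Proof. by rewrite mulrC powRrM powR_mulrn// powR_ge0. Qed.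

Lemma powR_root (a : R) (m : nat) : 0 <= a -> (0 < m)%N -> (a `^ (m%:R^-1)) ^+ m = a.
Proof.
move=> a0 m0; rewrite -powR_mulrn ?powR_ge0// -powRrM mulVf ?powRr1//.
by rewrite pnatr_eq0 -lt0n.
Qed.

(** With [y = p^3] the real power becomes [p^-2], and statements about [alpha] reduce to polynomial
    ones. *)
Lemma cube_rootP (y : R) : 0 < y ->
  exists p, [/\ 0 < p, p ^+ 3 = y & y `^ (- (2 / 3)) = p ^- 2].
Proof.
move=> y0; exists (y `^ (3%:R^-1)); split.
- exact: powR_gt0.
- by rewrite powR_root// ltW.
- by rewrite powRN (powR_frac y 2 3).
Qed.

Lemma lt_cube_ge0 (p q : R) : 0 <= q -> p ^+ 3 <= q ^+ 3 -> p <= q.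
Proof.
move=> q0 h; have [p0|p0] := leP 0 p; first by rewrite -(@ler_pXn2r _ 3).
exact: le_trans (ltW p0) q0.
Qed.

Lemma exists_between0 e : (0 < e)%E -> exists x : R, [/\ 0 < x, x < 1 & (x%:E < e)%E].
Proof.
case: e => [r|_|//]; last by exists 2^-1; split; rewrite ?ltry//; lra.
rewrite lte_fin => r0; exists (Num.min r 1 / 2); rewrite lte_fin.
have : 0 < Num.min r 1 by rewrite lt_min r0 ltr01.
have : Num.min r 1 <= r by rewrite ge_min lexx.
have : Num.min r 1 <= 1 by rewrite ge_min lexx orbT.
by move: (Num.min r 1) => m; split; lra.
Qed.

Lemma exists_le0 e : (0 < e)%E -> exists2 x : R, 0 < x & (x%:E <= e)%E.
Proof. by move=> /exists_between0[x [x0 _ xe]]; exists x => //; exact: ltW. Qed.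

Lemma sub_cube_gt0 x : 0 < x -> x < 1 -> 0 < x - x ^+ 3.
Proof. by move=> x0 x1; have : x ^+ 2 < 1 by [nra]; nra. Qed.

Lemma le_alpha e c : (0 < e)%E ->
  (forall x, 0 < x -> x < 1 -> (x%:E < e)%E -> c <= (x - x ^+ 3) `^ (- (2 / 3))) ->
  c <= alpha e.
Proof.
move=> e0 h; apply: lb_le_inf => [|_ [x /= [x0 [xe x1]] <-]]; last exact: h.
have [x [x0 x1 xe]] := exists_between0 _ e0.
by exists ((x - x ^+ 3) `^ (- (2 / 3))), x.
Qed.

Lemma alpha_le e x : 0 < x -> x < 1 -> (x%:E < e)%E ->
  alpha e <= (x - x ^+ 3) `^ (- (2 / 3)).
Proof.
move=> x0 x1 xe; apply: ge_inf; last by exists x.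
by exists 0 => _ [y _ <-]; exact: powR_ge0.
Qed.

Lemma alpha_ge1 e : (0 < e)%E -> 1 <= alpha e.
Proof.
move=> e0; apply: le_alpha => // x x0 x1 _.
have [p [p0 p3 ->]] := cube_rootP _ (sub_cube_gt0 _ x0 x1).
have : p <= 1 by apply: lt_cube_ge0 => //; rewrite p3; have := exprn_gt0 3 x0; lra.
by move=> p1; rewrite invf_ge1 ?exprn_gt0// exprn_ile1// ltW.
Qed.

Lemma alpha_gt0 e : (0 < e)%E -> 0 < alpha e.
Proof. by move=> /alpha_ge1; lra. Qed.

Lemma alpha_anti e1 e2 : (0 < e1)%E -> (e1 <= e2)%E -> alpha e2 <= alpha e1.
Proof.
move=> e0 e12; apply: le_alpha => // x x0 x1 xe; apply: alpha_le => //.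
exact: lt_le_trans e12.
Qed.

Lemma alpha_oo : alpha (+oo%E : \bar R) = 3 * 2 `^ (- (2 / 3)).
Proof.
pose x0 : R := (Num.sqrt 3)^-1.
have s3 : 0 < Num.sqrt 3 :> R by rewrite sqrtr_gt0.
have x00 : 0 < x0 by rewrite invr_gt0.
have x02 : x0 ^+ 2 = 3^-1 by rewrite exprVn sqr_sqrtr.
have x01 : x0 < 1 by nra.
have two0 : 0 < 2 :> R by [].
have [q [q0 q3 ->]] := cube_rootP 2 two0.
have e0 : x0 - x0 ^+ 3 = (q * x0) ^+ 3.
  by rewrite exprMn q3 exprS x02; field.
have E : (x0 - x0 ^+ 3) `^ (- (2 / 3)) = 3 * q ^- 2.
  have [p [p0 p3 ->]] := cube_rootP _ (sub_cube_gt0 _ x00 x01).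
  have -> : p = q * x0.
    have qx : 0 <= q * x0 by rewrite mulr_ge0 ?ltW.
    by apply/eqP; rewrite eq_le; apply/andP; split; apply: lt_cube_ge0;
      rewrite ?(ltW p0)// p3 e0.
  by rewrite exprMn x02 invfM invrK mulrC.
apply/eqP; rewrite eq_le -{1}E alpha_le ?ltry//=.
apply: le_alpha => // x xp x1 _; rewrite -E.
have [p [p0 p3 ->]] := cube_rootP _ (sub_cube_gt0 _ x00 x01).
have [p' [p'0 p'3 ->]] := cube_rootP _ (sub_cube_gt0 _ xp x1).
rewrite lef_pV2 ?posrE ?exprn_gt0// lerXn2r ?nnegrE ?(ltW p0) ?(ltW p'0)//.
apply: lt_cube_ge0; first exact: ltW.
rewrite p3 p'3.
(* With [3 x0^2 = 1] this product equals [x^3 - x + 2 x0^3], and [2 x0^3 = x0 - x0^3]: the maximum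
   of [x - x^3] is at [x0]. *)
have : 0 <= (x - x0) ^+ 2 * (x + 2 * x0) by rewrite mulr_ge0 ?sqr_ge0; lra.
have : x0 ^+ 3 = x0 / 3 by rewrite exprSr x02 mulrC.
have : 3 * (x0 ^+ 2 * x) = x by rewrite x02; field.
by lra.
Qed.

Lemma tau0_gt0 e : (0 < e)%E -> 0 < tau0 e.
Proof. by move=> e0; rewrite sqrtr_gt0 divr_gt0// alpha_gt0. Qed.

Lemma sqr_tau0 e : (0 < e)%E -> tau0 e ^+ 2 = 2 / alpha e.
Proof. by move=> e0; rewrite sqr_sqrtr// divr_ge0// ltW// alpha_gt0. Qed.

Lemma lt_tau0 e u : (0 < e)%E -> 0 <= u -> u < tau0 e -> alpha e * u ^+ 2 / 2 < 1.
Proof.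
move=> e0 u0 ut; have a0 := alpha_gt0 _ e0.
have : u ^+ 2 < 2 / alpha e.
  by rewrite -sqr_tau0// ltrXn2r// nnegrE ltW// tau0_gt0.
by rewrite ltr_pdivlMr//; lra.
Qed.

Lemma tau0_anti e1 e2 : (0 < e1)%E -> (e1 <= e2)%E -> tau0 e1 <= tau0 e2.
Proof.
move=> e0 e12; have e20 := lt_le_trans e0 e12.
have a1 := alpha_gt0 _ e0; have a2 := alpha_gt0 _ e20.
rewrite ler_sqrt; last by rewrite divr_ge0// ltW.
by apply: ler_wpM2l => //; rewrite lef_pV2 ?posrE// alpha_anti.
Qed.

Lemma le_alpha1 e L c : (0 < e)%E -> 0 < L ->
  (forall u, 0 < u -> ((u * L)%:E <= e)%E -> c <= u / 2 + alpha e / (4 * u)) ->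
  c <= alpha1 e L.
Proof.
move=> e0 L0 h; apply: lb_le_inf => [|_ [u /= [u0 ue] <-]]; last exact: h.
have [x x0 xe] := exists_le0 _ e0.
exists (x / L / 2 + alpha e / (4 * (x / L))), (x / L) => //=.
by rewrite divr_gt0// divfK ?gt_eqF.
Qed.

Lemma alpha1_le e L u : (0 < e)%E -> 0 < u -> ((u * L)%:E <= e)%E ->
  alpha1 e L <= u / 2 + alpha e / (4 * u).
Proof.
move=> e0 u0 ue; apply: ge_inf; last by exists u.
exists 0 => _ [y [/= y0 _] <-].
by rewrite addr_ge0// divr_ge0 ?ltW ?alpha_gt0 ?mulr_gt0.
Qed.

Lemma sqrt_half_alpha e : (0 < e)%E ->
  0 < Num.sqrt (alpha e / 2) /\ alpha e = 2 * Num.sqrt (alpha e / 2) ^+ 2.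
Proof.
move=> e0; have a0 := alpha_gt0 _ e0; rewrite sqrtr_gt0 sqr_sqrtr; last by lra.
by split; lra.
Qed.

(** Arithmetic-geometric mean: the excess over [s = sqrt (alpha / 2)] is [(u - s)^2 / (2 u)], so
    [u = s] is the unconstrained minimizer. *)
Lemma alpha1_ge e L : (0 < e)%E -> 0 < L -> Num.sqrt (alpha e / 2) <= alpha1 e L.
Proof.
move=> e0 L0; apply: le_alpha1 => // u u0 _.
have [s0 sa] := sqrt_half_alpha _ e0.
set s := Num.sqrt _ in s0 sa *; rewrite sa -subr_ge0.
have -> : u / 2 + 2 * s ^+ 2 / (4 * u) - s = (u - s) ^+ 2 / (2 * u).
  by field; rewrite gt_eqF.
by rewrite divr_ge0 ?sqr_ge0// mulr_ge0// ltW.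
Qed.

Lemma alpha1_gt0 e L : (0 < e)%E -> 0 < L -> 0 < alpha1 e L.
Proof.
by move=> e0 L0; apply: lt_le_trans (alpha1_ge _ _ e0 L0); case: (sqrt_half_alpha _ e0).
Qed.

Lemma alpha1_small e L : (0 < e)%E -> 0 < L -> (L%:E <= L0 e)%E ->
  alpha1 e L = Num.sqrt (alpha e / 2).
Proof.
move=> e0 Lp LL; apply/eqP; rewrite eq_le alpha1_ge// andbT.
have [s0 sa] := sqrt_half_alpha _ e0.
have -> : Num.sqrt (alpha e / 2) =
    Num.sqrt (alpha e / 2) / 2 + alpha e / (4 * Num.sqrt (alpha e / 2)).
  by rewrite {3}sa; field; rewrite gt_eqF.
apply: alpha1_le => //.
(* [tau0 e] and the minimizer are reciprocal, so [L <= L0 e] says that the minimizer times [L] is at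
   most [e], which is its admissibility. *)
have ts : tau0 e * Num.sqrt (alpha e / 2) = 1.
  rewrite -sqrtrM; last by rewrite divr_ge0// ltW// alpha_gt0.
  have -> : 2 / alpha e * (alpha e / 2) = 1 by field; rewrite gt_eqF// alpha_gt0.
  exact: sqrtr1.
case: e e0 LL s0 sa ts => [r|_ _ _ _ _|//]; last by rewrite leey.
rewrite /L0 -EFinM !lee_fin lte_fin => r0 LL s0 _ ts.
have := ler_wpM2l (ltW s0) LL.
by rewrite mulrCA [X in r * X]mulrC ts mulr1.
Qed.

Lemma alpha1_mono e L1 L2 : (0 < e)%E -> 0 < L1 -> L1 <= L2 ->
  alpha1 e L1 <= alpha1 e L2.
Proof.
move=> e0 L10 L12; apply: le_alpha1 => //; first exact: lt_le_trans L12.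
move=> u u0 ue; apply: alpha1_le => //; apply: le_trans ue.
by rewrite lee_fin ler_wpM2l// ltW.
Qed.

Lemma alpha1_anti e1 e2 L : (0 < e1)%E -> (e1 <= e2)%E -> 0 < L ->
  alpha1 e2 L <= alpha1 e1 L.
Proof.
move=> e0 e12 L0; apply: le_alpha1 => // u u0 ue.
apply: (le_trans (alpha1_le _ _ _ (lt_le_trans e0 e12) u0 (le_trans ue e12))).
rewrite lerD2l; apply: ler_wpM2r; last exact: alpha_anti.
by rewrite invr_ge0 mulr_ge0// ltW.
Qed.

(* [L^4 t^4 B(L|t|, e, L)] without the junk value of [B] at [t = 0]. *)
Definition rem_term t e L : R :=
  4 * alpha1 e L / alpha e ^+ 2 * log_rem (alpha e * (L * `|t|) ^+ 2 / 2).

Lemma norm_expr4 t : `|t| ^+ 4 = t ^+ 4.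
Proof. by rewrite -normrX ger0_norm// exprn_even_ge0. Qed.

Lemma B3E t e L : (0 < e)%E -> 0 < L ->
  L ^+ 4 * t ^+ 4 * B3 (L * `|t|) e L = rem_term t e L.
Proof.
move=> e0 Lp; rewrite /rem_term.
have [->|t0] := eqVneq t 0.
  by rewrite normr0 !mulr0 !expr0n/= !mulr0 !mul0r log_rem0 mulr0.
have a0 := alpha_gt0 _ e0.
rewrite /B3 /log_rem.
have -> : (L * `|t|) ^+ 4 = L ^+ 4 * t ^+ 4.
  by rewrite exprMn norm_expr4.
by field; rewrite t0 !gt_eqF.
Qed.

Let arg01 t e L : (0 < e)%E -> 0 < L -> L * `|t| < tau0 e ->
  0 <= alpha e * (L * `|t|) ^+ 2 / 2 < 1.
Proof.
move=> e0 Lp Lt; apply/andP; split; last first.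
  by apply: lt_tau0 => //; rewrite mulr_ge0// ltW.
by rewrite divr_ge0// mulr_ge0 ?sqr_ge0// ltW// alpha_gt0.
Qed.

Lemma rem_term_ge0 t e L : (0 < e)%E -> 0 < L -> L * `|t| < tau0 e ->
  0 <= rem_term t e L.
Proof.
move=> e0 Lp Lt; rewrite /rem_term mulr_ge0 ?log_rem_ge0 ?arg01//.
by rewrite divr_ge0 ?sqr_ge0// mulr_ge0// ltW// alpha1_gt0.
Qed.

Lemma rem_term_mono t e L1 L2 : (0 < e)%E -> 0 < L1 -> L1 <= L2 ->
  L2 * `|t| < tau0 e -> rem_term t e L1 <= rem_term t e L2.
Proof.
move=> e0 L10 L12 Lt; have L20 := lt_le_trans L10 L12.
have h12 : L1 * `|t| <= L2 * `|t| by rewrite ler_wpM2r.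
have a0 := alpha_gt0 _ e0.
have /andP[x0 x1] := arg01 _ _ _ e0 L10 (le_lt_trans h12 Lt).
have /andP[_ y1] := arg01 _ _ _ e0 L20 Lt.
apply: ler_pM; rewrite ?log_rem_ge0 ?x0 ?x1//.
- by rewrite divr_ge0 ?sqr_ge0// mulr_ge0// ltW// alpha1_gt0.
- by rewrite ler_wpM2r ?invr_ge0 ?sqr_ge0// ler_wpM2l// alpha1_mono.
- apply: log_rem_le => //; rewrite ler_wpM2r// ler_wpM2l ?(ltW a0)//.
  by rewrite lerXn2r// nnegrE mulr_ge0// ltW.
Qed.

(** [alpha1] decreases in [e]. So does [log_rem (alpha y / 2) / alpha^2], which up to the constant
    [(y / 2)^2] is the increasing quotient [log_rem x / x^2] at [x = alpha y / 2]. *)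
Lemma rem_term_anti t e1 e2 L : (0 < e1)%E -> (e1 <= e2)%E -> 0 < L ->
  L * `|t| < tau0 e1 -> rem_term t e2 L <= rem_term t e1 L.
Proof.
move=> e10 e12 Lp Lt; have e20 := lt_le_trans e10 e12.
have a10 := alpha_gt0 _ e10; have a20 := alpha_gt0 _ e20.
have a12 := alpha_anti _ _ e10 e12.
have Lt2 := lt_le_trans Lt (tau0_anti _ _ e10 e12).
have /andP[x0 x1] := arg01 _ _ _ e20 Lp Lt2.
have /andP[y0 y1] := arg01 _ _ _ e10 Lp Lt.
rewrite /rem_term; set y := (L * `|t|) ^+ 2 in x0 x1 y0 y1 *.
have [y00|yn0] := eqVneq y 0; first by rewrite y00 !mulr0 !mul0r log_rem0 !mulr0.
have yp : 0 < y by rewrite lt_def yn0 sqr_ge0.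
have key : log_rem (alpha e2 * y / 2) / alpha e2 ^+ 2 <=
    log_rem (alpha e1 * y / 2) / alpha e1 ^+ 2.
  rewrite ler_pdivrMr ?exprn_gt0// [leRHS]mulrAC ler_pdivlMr ?exprn_gt0//.
  have := @log_rem_ratio _ (alpha e2 * y / 2) (alpha e1 * y / 2) x0.
  have h : alpha e2 * y / 2 <= alpha e1 * y / 2 by nra.
  move=> /(_ h y1) h2.
  have w0 : 0 < (y / 2) ^+ 2 by rewrite exprn_gt0// divr_gt0.
  by rewrite -(ler_pM2r w0); lra.
have F e : 4 * alpha1 e L / alpha e ^+ 2 * log_rem (alpha e * y / 2) =
    4 * alpha1 e L * (log_rem (alpha e * y / 2) / alpha e ^+ 2) by ring.
rewrite !F; apply: ler_pM => //.
- by rewrite mulr_ge0// ltW// alpha1_gt0.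
- by rewrite divr_ge0 ?sqr_ge0// log_rem_ge0// x0 x1.
- by rewrite ler_wpM2l// alpha1_anti.
Qed.

Lemma B2_denom_gt0 tau e : (0 < e)%E -> 0 <= tau -> tau < tau0 e ->
  0 < 2 - alpha e * tau ^+ 2.
Proof. by move=> e0 t0 /(lt_tau0 _ _ e0 t0); lra. Qed.

Lemma B2_ge0 tau e : (0 < e)%E -> 0 <= tau -> tau < tau0 e -> 0 <= B2 tau e.
Proof.
by move=> e0 t0 tt; rewrite divr_ge0 ?sqrtr_ge0// ltW// B2_denom_gt0.
Qed.

Lemma B2_anti tau e1 e2 : (0 < e1)%E -> (e1 <= e2)%E -> 0 <= tau -> tau < tau0 e1 ->
  B2 tau e2 <= B2 tau e1.
Proof.
move=> e10 e12 t0 tt; have e20 := lt_le_trans e10 e12.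
have a12 := alpha_anti _ _ e10 e12.
have tt2 := lt_le_trans tt (tau0_anti _ _ e10 e12).
have d1 := B2_denom_gt0 _ _ e10 t0 tt; have d2 := B2_denom_gt0 _ _ e20 t0 tt2.
apply: ler_pM.
- exact: sqrtr_ge0.
- by rewrite invr_ge0 ltW.
- rewrite ler_sqrt; last by rewrite divr_ge0// ltW// alpha_gt0.
  by rewrite ler_wpM2r.
- by rewrite lef_pV2 ?posrE// lerD2l lerN2 ler_wpM2r// sqr_ge0.
Qed.

(** For [L <= L0 e] the constant [alpha1] is [sqrt (alpha / 2)], and [log_rem_bound] at
    [alpha y^2 / 2] with [y = L |t|] gives exactly [y^4 B2 y e]; the fraction increases from [y] to
    [tau]. *)
Lemma rem_term_le t tau e L : (0 < e)%E -> 0 < L -> (L%:E <= L0 e)%E ->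
  L * `|t| < tau -> tau < tau0 e ->
  rem_term t e L <= L ^+ 4 * t ^+ 4 * B2 tau e.
Proof.
move=> e0 Lp LL Lt tt; have a0 := alpha_gt0 _ e0.
have Lt0 : 0 <= L * `|t| by rewrite mulr_ge0// ltW.
have tau_ge0 : 0 <= tau := le_trans Lt0 (ltW Lt).
have h01 := arg01 _ _ _ e0 Lp (lt_trans Lt tt).
rewrite /rem_term alpha1_small// /B2.
have E4 : (L * `|t|) ^+ 4 = L ^+ 4 * t ^+ 4.
  by rewrite exprMn norm_expr4.
have := log_rem_bound _ _ h01; set y := L * `|t| in Lt Lt0 h01 E4 *.
rewrite -E4 => hb; have [s0 _] := sqrt_half_alpha _ e0; set s := Num.sqrt _ in s0 *.
have d1 := B2_denom_gt0 _ _ e0 tau_ge0 tt.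
have d2 := B2_denom_gt0 _ _ e0 Lt0 (lt_trans Lt tt).
apply: (@le_trans _ _ (4 * s / alpha e ^+ 2 *
    ((alpha e * y ^+ 2 / 2) ^+ 2 / (2 * (1 - alpha e * y ^+ 2 / 2))))).
  apply: ler_wpM2l => //.
  by rewrite divr_ge0 ?sqr_ge0// mulr_ge0// ltW.
have -> : 4 * s / alpha e ^+ 2 *
    ((alpha e * y ^+ 2 / 2) ^+ 2 / (2 * (1 - alpha e * y ^+ 2 / 2))) =
   y ^+ 4 * (s / (2 - alpha e * y ^+ 2)).
  by field; rewrite !gt_eqF//; lra.
apply: ler_wpM2l; first exact: exprn_ge0.
apply: ler_wpM2l; first exact: ltW.
rewrite lef_pV2 ?posrE// lerD2l lerN2; apply: ler_wpM2l; first exact: ltW.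
by rewrite lerXn2r ?nnegrE// ltW.
Qed.

(** * The functions [p_E] and [p_R] *)

Lemma p_E_le t e g z : 0 < g -> 0 < z -> (z%:E <= e)%E ->
  p_E t e g <= t ^+ 2 * (z * t ^+ 2 / 12
    + Num.max (`|t| / (6 * g)) (kappa R / z - z * t ^+ 2 / 24)).
Proof.
move=> g0 z0 ze; rewrite ler_wpM2l ?sqr_ge0//; apply: ge_inf; last by exists z.
exists 0 => _ [y [/= y0 _] <-]; rewrite addr_ge0//.
  by rewrite divr_ge0// mulr_ge0 ?sqr_ge0// ltW.
by rewrite le_max divr_ge0// mulr_ge0// ltW.
Qed.

Lemma le_p_E t e g c : (0 < e)%E ->
  (forall z, 0 < z -> (z%:E <= e)%E -> c <= t ^+ 2 * (z * t ^+ 2 / 12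
    + Num.max (`|t| / (6 * g)) (kappa R / z - z * t ^+ 2 / 24))) -> c <= p_E t e g.
Proof.
move=> e0 h; have [x x0 xe] := exists_le0 _ e0.
have [t0|t0] := eqVneq t 0.
  by have := h x x0 xe; rewrite /p_E t0 expr0n/= !mul0r.
have t2 : 0 < t ^+ 2 by rewrite exprn_even_gt0.
rewrite /p_E -ler_pdivrMl//; apply: lb_le_inf => [|_ [z [/= z0 ze] <-]].
  by eexists; exists x.
by rewrite ler_pdivrMl// h.
Qed.

Lemma p_E_ge0 t e g : (0 < e)%E -> 0 < g -> 0 <= p_E t e g.
Proof.
move=> e0 g0; apply: le_p_E => // z z0 _; rewrite mulr_ge0 ?sqr_ge0// addr_ge0//.
  by rewrite divr_ge0// mulr_ge0 ?sqr_ge0// ltW.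
by rewrite le_max divr_ge0// mulr_ge0// ltW.
Qed.

Lemma p_E_anti_g t e g1 g2 : (0 < e)%E -> 0 < g1 -> g1 <= g2 ->
  p_E t e g2 <= p_E t e g1.
Proof.
move=> e0 g10 g12; apply: le_p_E => // z z0 ze.
apply: (le_trans (p_E_le _ _ _ _ (lt_le_trans g10 g12) z0 ze)).
rewrite ler_wpM2l ?sqr_ge0// lerD2l ge_max !le_max lexx orbT andbT.
by apply/orP; left; apply: ler_wpM2l => //; rewrite lef_pV2 ?posrE; lra.
Qed.

Lemma p_E_anti t e1 e2 g : (0 < e1)%E -> (e1 <= e2)%E -> 0 < g ->
  p_E t e2 g <= p_E t e1 g.
Proof.
move=> e0 e12 g0; apply: le_p_E => // z z0 ze; apply: p_E_le => //.
exact: le_trans e12.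
Qed.

Lemma p_R_ge0 t eps g : 0 < eps -> 0 < g -> 0 <= p_R t eps g.
Proof.
by move=> e0 g0; rewrite mulr_ge0 ?sqr_ge0// le_max divr_ge0// mulr_ge0// ltW.
Qed.

Lemma p_R_anti_g t eps g1 g2 : 0 < g1 -> g1 <= g2 -> p_R t eps g2 <= p_R t eps g1.
Proof.
move=> g10 g12; rewrite ler_wpM2l ?sqr_ge0//.
set m := Num.max (_ + _) _; rewrite ge_max; apply/andP; split; rewrite le_max.
  by apply/orP; left; apply: ler_wpM2l => //; rewrite lef_pV2 ?posrE; lra.
by rewrite lexx orbT.
Qed.

(** By the arithmetic-geometric mean the right side is at least [|t| sqrt (kappa / 6)], and
    [gamma_star] solves [1 / (6 g) = sqrt (kappa / 6)]. From there on the first entry of the maximum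
    in [p_R] is inactive. *)
Lemma norm_div_gamma_le t eps g : 0 < eps -> gamma_star R <= g ->
  `|t| / (6 * g) <= kappa R / eps + eps * t ^+ 2 / 24.
Proof.
move=> e0 gg; have k0 := kappa_gt0 R.
have s0 : 0 < Num.sqrt (6 * kappa R) by rewrite sqrtr_gt0 mulr_gt0.
have sk : Num.sqrt (6 * kappa R) ^+ 2 = 6 * kappa R by rewrite sqr_sqrtr// mulr_ge0// ltW.
have gs0 : 0 < gamma_star R by rewrite invr_gt0.
apply: (@le_trans _ _ (`|t| / (6 * gamma_star R))).
  by apply: ler_wpM2l => //; rewrite lef_pV2 ?posrE; lra.
rewrite /gamma_star; set s := Num.sqrt _ in s0 sk *.
have -> : kappa R = s ^+ 2 / 6 by rewrite sk; field.
rewrite -[t ^+ 2]real_normK ?num_real// -subr_ge0.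
have -> : s ^+ 2 / 6 / eps + eps * `|t| ^+ 2 / 24 - `|t| / (6 / s) =
    (2 * s - eps * `|t|) ^+ 2 / (24 * eps).
  by field; rewrite !gt_eqF.
by rewrite divr_ge0 ?sqr_ge0// mulr_ge0// ltW.
Qed.

Lemma p_R_const t eps g1 g2 : 0 < eps -> gamma_star R <= g1 -> gamma_star R <= g2 ->
  p_R t eps g1 = p_R t eps g2.
Proof.
move=> e0 h1 h2; congr (_ * _).
have mx g : gamma_star R <= g -> Num.max (`|t| / (6 * g))
    (Num.max (kappa R / eps + eps * t ^+ 2 / 24) (eps * t ^+ 2 / 12)) =
    Num.max (kappa R / eps + eps * t ^+ 2 / 24) (eps * t ^+ 2 / 12).
  by move=> hg; apply/max_idPr; rewrite le_max norm_div_gamma_le.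
by rewrite !mx.
Qed.

End parameters.

(** * Bounds for the characteristic function *)

Section charfun_bounds.
Context {R : realType} {d : measure_display} {T : measurableType d}.
Variables (P : probability T R) (n : nat) (X : 'I_n -> {RV P >-> R}).
Hypothesis X2 : forall k, P.-integrable setT (EFin \o (fun w => X k w ^+ 2)).
Hypothesis EX0 : forall k, ('E_P[X k] = 0)%E.
Hypothesis sumX2 : \sum_(k < n) fine ('E_P[fun w => X k w ^+ 2]) = 1.

Local Notation sg k := (mom P (X k) (fun x => x ^+ 2)).
Local Notation Lam := (fun h : R -> R => \sum_(k < n) mom P (X k) h).

Let posm k : pos_linear R (mom P (X k)) := pos_linear_mom P (X k) (X2 k).
Let posLam : pos_linear R Lam := pos_linear_sum R _ _ posm.

Let mom_id k : mom P (X k) id = 0.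
Proof. by rewrite /mom -[fun w => _]/(X k : T -> R) EX0. Qed.

Let sum_sg : \sum_k sg k = 1. Proof. exact: sumX2. Qed.

Let sg_ge0 k : 0 <= sg k. Proof. exact: sqr_moment_ge0 (posm k). Qed.

Let sg_le1 k : sg k <= 1.
Proof.
by rewrite -sum_sg (bigD1 k)//= lerDl; apply: sumr_ge0 => i _; exact: sg_ge0.
Qed.

Lemma L_n_ge0 z : 0 <= L_n X z.
Proof. exact: (tail2_ge0 R _ posLam). Qed.

Let tail2_le_L_n k z : mom P (X k) (tail2 R z) <= L_n X z.
Proof.
rewrite /L_n (bigD1 k)//= lerDl; apply: sumr_ge0 => i _.
exact: (tail2_ge0 R _ (posm i)).
Qed.

(** * Consequences of [y L_n(y) <= L^3], the property common to both fractions *)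

Section fraction.
Variables (e : \bar R) (L t : R).
Hypotheses (e0 : (0 < e)%E) (L0 : 0 < L).
Hypothesis hL : forall y, 0 < y -> (y%:E <= e)%E -> y * L_n X y <= L ^+ 3.

(** Splitting [sigma^2] at [x sigma] and multiplying by [x sigma] gives [(x - x^3) sigma^3 <= x
    sigma L_n(x sigma) <= L^3]; the infimum over [x] is the origin of [alpha]. The level is
    admissible because [sigma <= 1]. *)
Lemma variance_le k : sg k <= alpha e * L ^+ 2.
Proof.
rewrite -ler_pdivrMr ?exprn_gt0//; apply: le_alpha => // x x0 x1 xe.
have [p [p0 p3 ->]] := cube_rootP _ _ (sub_cube_gt0 _ _ x0 x1).
pose s := Num.sqrt (sg k).
have s2 : s ^+ 2 = sg k by rewrite sqr_sqrtr.
have s0 : 0 <= s by exact: sqrtr_ge0.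
have s1 : s <= 1 by rewrite -(@ler_pXn2r _ 2)// ?nnegrE// s2 expr1n.
suff : s * p <= L.
  move=> h; rewrite ler_pdivrMr ?exprn_gt0// ler_pdivlMl ?exprn_gt0// -s2 mulrC.
  by rewrite -exprMn lerXn2r// nnegrE ?mulr_ge0// ltW.
apply: lt_cube_ge0; first exact: ltW.
have [->|sn0] := eqVneq s 0; first by rewrite mul0r expr0n exprn_ge0// ltW.
have sp : 0 < s by rewrite lt_def sn0.
have xs0 : 0 < x * s by rewrite mulr_gt0.
have xse : ((x * s)%:E <= e)%E.
  by apply: le_trans (ltW xe); rewrite lee_fin ger_pMr.
have h1 := sqr_moment_split R _ (posm k) (x * s) (mom_cst P (X k) 1).
have h2 := hL _ xs0 xse.
have h3 := ler_wpM2l (ltW xs0) (le_trans h1 (lerD (lexx _) (tail2_le_L_n k (x * s)))).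
rewrite -s2 in h3; rewrite exprMn p3.
by apply: le_trans h2; lra.
Qed.

(** At the level [u L] the two terms of [sqr_moment_sqr_le] sum to at most [alpha L^4 / u] and
    [2 u L^4], together [4 L^4] times the function of [u] minimized in [alpha1]. *)
Lemma sum_variance_sqr_le : \sum_k sg k ^+ 2 <= 4 * alpha1 e L * L ^+ 4.
Proof.
have L4 : 0 < 4 * L ^+ 4 by rewrite mulr_gt0// exprn_gt0.
rewrite mulrAC -ler_pdivrMl//; apply: le_alpha1 => // u u0 ue.
rewrite ler_pdivrMl//.
have z0 : 0 < u * L by rewrite mulr_gt0.
have hL' y : 0 < y -> y <= u * L -> y * L_n X y <= L ^+ 3.
  by move=> y0 yz; apply: hL => //; apply: le_trans ue; rewrite lee_fin.
have h1 : \sum_k sg k ^+ 2 <= \sum_k (alpha e * L ^+ 2 * mom P (X k) (tail2 R (u * L))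
    + mom P (X k) (trunc4 R (u * L))).
  apply: ler_sum => k _; rewrite expr2.
  apply: (le_trans (sqr_moment_sqr_le R _ (posm k) _ z0 (mom_cst P (X k) 1))).
  by rewrite lerD2r ler_wpM2r ?variance_le// (tail2_ge0 R _ (posm k)).
apply: (le_trans h1); rewrite big_split/= -mulr_sumr.
have h2 := trunc4_le R _ posLam _ _ z0 hL'.
have h3 := hL' _ z0 (lexx _).
have a0 := alpha_gt0 _ _ e0.
have h4 : alpha e * L ^+ 2 * L_n X (u * L) <= alpha e * L ^+ 4 / u.
  rewrite ler_pdivlMr//.
  have := ler_wpM2l (mulr_ge0 (ltW a0) (ltW L0)) h3; lra.
apply: (le_trans (lerD h4 h2)).
by rewrite le_eqVlt; apply/orP; left; apply/eqP; field; rewrite gt_eqF.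
Qed.

(** [D] bounds the modulus of the sum of the [w_k + a_k] through its linear forms and is where the
    two fractions are treated differently. That [D] is nonnegative follows from the opposite
    directions [(1, 0)] and [(-1, 0)]. *)
Lemma r_n_le (D : R) : L * `|t| < tau0 e ->
  (forall u v : R, u ^+ 2 + v ^+ 2 = 1 ->
    u * (Lam (fun x => cos (t * x)) - Lam (fun=> 1) + t ^+ 2 / 2) +
    v * Lam (fun x => sin (t * x)) <= D) ->
  r_n X t <= (expR (D + rem_term R t e L) - 1) * expR (- (t ^+ 2) / 2).
Proof.
move=> Lt hD.
pose w k := charfun (X k) t - 1.
pose a k := sg k * t ^+ 2 / 2.
have t2 : 0 <= t ^+ 2 := sqr_ge0 t.
have a0 k : 0 <= a k by rewrite divr_ge0// mulr_ge0.
have al0 := alpha_gt0 _ _ e0.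
have Y1 : alpha e * (L * `|t|) ^+ 2 / 2 < 1.
  by apply: lt_tau0 => //; rewrite mulr_ge0// ltW.
have YE : (L * `|t|) ^+ 2 = L ^+ 2 * t ^+ 2 by rewrite exprMn real_normK ?num_real.
have aY k : a k <= alpha e * (L * `|t|) ^+ 2 / 2.
  by rewrite ler_wpM2r// YE mulrA ler_wpM2r// variance_le.
have a1 k : a k < 1 := le_lt_trans (aY k) Y1.
have ReIm k : charfun (X k) t =
    (mom P (X k) (fun x => cos (t * x)) +i* mom P (X k) (fun x => sin (t * x)))%C by [].
have wa k : Normc.normc (w k) <= a k.
  apply: normc_le_dot => // u v uv.
  have := charfun_sub1_dot_le R _ (posm k) u v t uv.
  by rewrite (mom_cst P (X k) 1) mom_id /w ReIm /=; rewrite /a; lra.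
have sumE (f : R) : \sum_k (sg k * f) = f by rewrite -mulr_suml sum_sg mul1r.
have suma : \sum_k a k = t ^+ 2 / 2.
  by rewrite /a; under eq_bigr do rewrite -mulrA; rewrite sumE.
have := normc_prod_sub_exp_le _ _ w a wa a1.
rewrite suma -mulNr.
have -> : \prod_k (1 + w k) = fbar X t.
  by apply: eq_bigr => k _; rewrite /w addrC subrK.
move=> h; apply: (le_trans h); rewrite ler_wpM2r ?expR_ge0// lerD2r ler_expR lerD//.
- have ReD : complex.Re (\sum_k (w k + (a k)%:C%C)) =
      Lam (fun x => cos (t * x)) - Lam (fun=> 1) + t ^+ 2 / 2.
    rewrite -suma -sumrB -big_split/= Re_sum; apply: eq_bigr => k _.
    by rewrite (mom_cst P (X k) 1) /w ReIm.
  have ImD : complex.Im (\sum_k (w k + (a k)%:C%C)) = Lam (fun x => sin (t * x)).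
    rewrite Im_sum; apply: eq_bigr => k _.
    by rewrite /w ReIm /= subr0 addr0.
  have := hD 1 0; have := hD (-1) 0; rewrite !expr2 => D1 D2.
  by apply: normc_le_dot => [|u v uv]; [lra|rewrite ReD ImD; exact: hD].
- rewrite /rem_term; set Y := alpha e * _ / 2 in aY Y1 *.
  have [t0|t0] := eqVneq t 0.
    rewrite /Y t0 normr0 mulr0 expr0n/= mulr0 mul0r log_rem0 mulr0 big1// => k _.
    by rewrite /a t0 expr0n/= mulr0 mul0r log_rem0.
  have tp : 0 < t ^+ 2 by rewrite exprn_even_gt0.
  have Yp : 0 < Y by rewrite divr_gt0// YE mulr_gt0// mulr_gt0// exprn_gt0.
  have lY : 0 <= log_rem Y by rewrite log_rem_ge0// (ltW Yp).
  (* Since [a_k <= Y], monotonicity of [log_rem x / x^2] replaces each [log_rem (a_k)] by a common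
     multiple of [a_k^2], that is of [sigma_k^4]. *)
  apply: (@le_trans _ _ (\sum_k (sg k ^+ 2 * (log_rem Y / (alpha e * L ^+ 2) ^+ 2)))).
    apply: ler_sum => k _.
    have := log_rem_ratio _ _ _ (a0 k) (aY k) Y1.
    rewrite -ler_pdivlMr ?exprn_gt0// => /le_trans; apply.
    rewrite le_eqVlt; apply/orP; left; apply/eqP.
    by rewrite /Y /a YE; field; rewrite t0 !gt_eqF.
  rewrite -mulr_suml.
  have -> : 4 * alpha1 e L / alpha e ^+ 2 * log_rem Y =
      4 * alpha1 e L * L ^+ 4 * (log_rem Y / (alpha e * L ^+ 2) ^+ 2).
    by field; rewrite !gt_eqF.
  by rewrite ler_wpM2r ?sum_variance_sqr_le// divr_ge0// sqr_ge0.
Qed.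

Lemma charfun_sum_dot_le (u v z S : R) : u ^+ 2 + v ^+ 2 = 1 -> 0 < z ->
  (forall y, 0 < y -> y <= z -> y * L_n X y <= S) ->
  u * (Lam (fun x => cos (t * x)) - Lam (fun=> 1) + t ^+ 2 / 2) +
    v * Lam (fun x => sin (t * x)) <=
  t ^+ 2 * (`|t| / 6 * `|M_n X z| + (kappa R - z ^+ 2 * t ^+ 2 / 24) * L_n X z
            + t ^+ 2 / 12 * (z * S)).
Proof.
move=> uv z0 hS.
have := charfun_dot_le R _ posLam u v t z S uv z0 hS.
by rewrite /= sum_sg mul1r [\sum_(k < n) mom P (X k) id]big1 ?mulr0 ?subr0.
Qed.

End fraction.

(** [D] is cut at an arbitrary [z <= e], which yields the infimum in [p_E]. The supremum in the
    fraction takes both of its terms at the same [z], so the larger of their coefficients can be put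
    in front of [g |M_n z| + z L_n z]. *)
Lemma r_n_le_rhs1_E (e : \bar R) (g L t : R) : (0 < e)%E -> 0 < g -> 0 < L ->
  (L ^+ 3)%:E = LE3 X e g -> L * `|t| < tau0 e -> r_n X t <= rhs1_E t e g L.
Proof.
move=> e0 g0 Lp LE Lt.
have hsup z : 0 < z -> (z%:E <= e)%E -> g * `|M_n X z| + z * L_n X z <= L ^+ 3.
  by move=> z0 ze; rewrite -lee_fin LE; apply: ereal_sup_ubound; exists z.
have hL z : 0 < z -> (z%:E <= e)%E -> z * L_n X z <= L ^+ 3.
  move=> z0 ze; apply: le_trans (hsup z z0 ze); rewrite lerDr mulr_ge0// ltW//.
have L3 : 0 < L ^+ 3 by rewrite exprn_gt0.
rewrite /rhs1_E B3E//; apply: (r_n_le e L t) => // u v uv.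
rewrite -ler_pdivrMl//; apply: le_p_E => // z z0 ze; rewrite ler_pdivrMl//.
apply: (le_trans (charfun_sum_dot_le t u v z (L ^+ 3) uv z0 _)).
  by move=> y y0 yz; apply: hL => //; apply: le_trans ze; rewrite lee_fin.
rewrite [leRHS]mulrCA; apply: ler_wpM2l; first exact: sqr_ge0.
have h := hsup z z0 ze; have l0 := L_n_ge0 z; have m0 := normr_ge0 (M_n X z).
set l := L_n X z in h l0 *; set m := `|M_n X z| in h m0 *.
set q1 := `|t| / (6 * g); set q2 := kappa R / z - z * t ^+ 2 / 24.
have q10 : 0 <= q1 by rewrite divr_ge0// mulr_ge0// ltW.
have -> : `|t| / 6 * m + (kappa R - z ^+ 2 * t ^+ 2 / 24) * l + t ^+ 2 / 12 * (z * L ^+ 3)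
   = q1 * (g * m) + q2 * (z * l) + L ^+ 3 * (z * t ^+ 2 / 12).
  by rewrite /q1 /q2; field; rewrite !gt_eqF.
rewrite mulrDr [leRHS]addrC lerD2r.
apply: (@le_trans _ _ (Num.max q1 q2 * (g * m + z * l))).
  rewrite mulrDr lerD// ler_wpM2r ?mulr_ge0 ?(ltW g0) ?(ltW z0)//.
    by rewrite le_max lexx.
  by rewrite le_max lexx orbT.
by rewrite mulrC ler_wpM2r// le_max q10.
Qed.

(** The cut is at [eps], where [M_n] is measured, while [S] is the supremum of [y L_n(y)] alone. The
    coefficient [q2 - q3] of [eps L_n(eps)] may have either sign: if nonnegative,
    [eps L_n(eps) <= S] gives [q2 S], otherwise [q3 S] remains. Hence the three entries in [p_R]. *)
Lemma r_n_le_rhs1_R (eps g L t : R) : 0 < eps -> 0 < g -> 0 < L ->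
  (L ^+ 3)%:E = LR3 X eps g -> L * `|t| < tau0 eps%:E -> r_n X t <= rhs1_R t eps g L.
Proof.
move=> e0 g0 Lp; rewrite /LR3; set sup := ereal_sup _ => LE Lt.
have sub y : 0 < y -> y <= eps -> ((y * L_n X y)%:E <= sup)%E.
  by move=> y0 ye; apply: ereal_sup_ubound; exists y.
(* A real total excludes [+oo], and the nonempty index set excludes [-oo]. *)
have [S SE] : exists S : R, sup = S%:E.
  case: sup LE sub => [S _ _|//|_ /(_ eps e0 (lexx _))//]; by exists S.
have hS y : 0 < y -> y <= eps -> y * L_n X y <= S.
  by move=> y0 ye; rewrite -lee_fin -SE sub.
move: LE; rewrite SE -EFinD => -[LE].
have m0 := normr_ge0 (M_n X eps).
have SL : S <= L ^+ 3 by rewrite LE lerDr mulr_ge0// ltW.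
rewrite /rhs1_R B3E//; apply: (r_n_le eps%:E L t) => //.
  by move=> y y0 ye; apply: le_trans SL; exact: hS.
move=> u v uv; apply: (le_trans (charfun_sum_dot_le t u v eps S uv e0 hS)).
rewrite /p_R [leRHS]mulrCA; apply: ler_wpM2l; first exact: sqr_ge0.
have l0 := L_n_ge0 eps; have lS := hS eps e0 (lexx _).
have el0 : 0 <= eps * L_n X eps by rewrite mulr_ge0// ltW.
rewrite LE; set l := L_n X eps in l0 lS el0 *; set m := `|M_n X eps| in m0 *.
set q1 := `|t| / (6 * g); set q2 := kappa R / eps + eps * t ^+ 2 / 24.
set q3 := eps * t ^+ 2 / 12.
have -> : `|t| / 6 * m + (kappa R - eps ^+ 2 * t ^+ 2 / 24) * l + t ^+ 2 / 12 * (eps * S)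
   = q1 * (g * m) + ((q2 - q3) * (eps * l) + q3 * S).
  by rewrite /q1 /q2 /q3; field; rewrite !gt_eqF.
rewrite [leRHS]mulrC [leRHS]mulrDr lerD//.
  by rewrite ler_wpM2r ?le_max ?lexx// mulr_ge0// ltW.
have S0 : 0 <= S := le_trans el0 lS.
apply: (@le_trans _ _ (Num.max q2 q3 * S)); last first.
  by rewrite ler_wpM2r// le_max lexx orbT.
have [h|h] := leP q2 q3; nra.
Qed.

End charfun_bounds.

(** * Comparison and monotonicity of the right-hand sides *)

Section right_hand_sides.
Variable R : realType.
Implicit Types (e : \bar R) (g L t tau : R).

Lemma two_powR_sixth (k : nat) : (2 : R) `^ (k%:R / 6) = (2 `^ (6^-1)) ^+ k.
Proof. exact: (powR_frac R 2 k 6). Qed.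

Lemma sqrt_eq (a b : R) : 0 <= a -> a ^+ 2 = b -> Num.sqrt b = a.
Proof. by move=> a0 <-; rewrite sqrtr_sqr ger0_norm. Qed.

(* With [r = 2^(1/6)], [alpha(oo) = 3 / r^4]. *)
Lemma alpha_oo_sixth : exists r : R, [/\ 0 < r, r ^+ 6 = 2, alpha (+oo%E : \bar R) = 3 / r ^+ 4
  & forall k : nat, (2 : R) `^ (k%:R / 6) = r ^+ k].
Proof.
exists (2 `^ (6^-1)); split.
- exact: powR_gt0.
- exact: (powR_root R 2 6).
- rewrite alpha_oo powRN; congr (_ * _^-1).
  by rewrite -two_powR_sixth; congr (_ `^ _); field.
- exact: two_powR_sixth.
Qed.

Lemma sqrt_half_alpha_oo (r : R) : 0 < r -> r ^+ 6 = 2 ->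
  Num.sqrt (3 / r ^+ 4 / 2) = Num.sqrt 3 / r ^+ 5.
Proof.
move=> r0 r6; apply: sqrt_eq; first by rewrite divr_ge0 ?sqrtr_ge0// exprn_ge0// ltW.
rewrite expr_div_n sqr_sqrtr// -r6; field; rewrite gt_eqF//.
Qed.

Lemma tau0_oo : tau0 (+oo%E : \bar R) = 2 `^ (5 / 6) / Num.sqrt 3.
Proof.
have [r [r0 r6 aE r2]] := alpha_oo_sixth; rewrite /tau0 aE (r2 5).
have s0 : 0 < Num.sqrt 3 :> R by rewrite sqrtr_gt0.
apply: sqrt_eq; first by rewrite divr_ge0 ?(ltW s0)// exprn_ge0// ltW.
rewrite expr_div_n sqr_sqrtr// -r6; field; rewrite gt_eqF//.
Qed.

Lemma B2_oo tau : B2 tau (+oo%E : \bar R) = B_inf tau.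
Proof.
have [r [r0 r6 aE r2]] := alpha_oo_sixth.
rewrite /B2 /B_inf aE sqrt_half_alpha_oo//.
have -> : 2 `^ (- (1 / 6)) = r^-1 :> R by rewrite powRN (r2 1).
have -> : 2 `^ (5 / 3) = r ^+ 10 :> R by rewrite -(r2 10); congr (_ `^ _); field.
have -> : r ^+ 10 - 3 * tau ^+ 2 = r ^+ 4 * (2 - 3 / r ^+ 4 * tau ^+ 2).
  by rewrite -r6; field; rewrite gt_eqF.
rewrite [in RHS]invfM; move: (2 - 3 / r ^+ 4 * tau ^+ 2)^-1 => D.
by field; rewrite gt_eqF.
Qed.

Lemma rem_term_oo t L : 0 < L ->
  rem_term R t +oo%E L = - (4 * Num.sqrt 2 * 3 `^ (- (3 / 2))
    * (ln (1 - 3 * 2 `^ (- (5 / 3)) * L ^+ 2 * t ^+ 2)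
       + 3 * 2 `^ (- (5 / 3)) * L ^+ 2 * t ^+ 2)).
Proof.
move=> Lp; have [r [r0 r6 aE r2]] := alpha_oo_sixth.
rewrite /rem_term alpha1_small ?ltry//; last first.
  by rewrite /L0 gt0_mulye ?leey// lte_fin tau0_gt0.
rewrite aE sqrt_half_alpha_oo// /log_rem.
have -> : 3 / r ^+ 4 * (L * `|t|) ^+ 2 / 2 = 3 * 2 `^ (- (5 / 3)) * L ^+ 2 * t ^+ 2.
  rewrite exprMn real_normK ?num_real// powRN.
  have -> : 2 `^ (5 / 3) = r ^+ 10 :> R by rewrite -(r2 10); congr (_ `^ _); field.
  by rewrite -r6; field; rewrite gt_eqF.
have -> : Num.sqrt 2 = r ^+ 3 :> R.
  by apply: sqrt_eq; [rewrite exprn_ge0// ltW|rewrite -exprM].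
have s0 : 0 < Num.sqrt 3 :> R by rewrite sqrtr_gt0.
have -> : 3 `^ (- (3 / 2)) = Num.sqrt 3 / 9 :> R.
  rewrite powRN (powR_frac R 3 3 2) powR12_sqrt//.
  have s2 : Num.sqrt 3 ^+ 2 = 3 :> R by rewrite sqr_sqrtr.
  have -> : 9 = (Num.sqrt 3 ^+ 2) ^+ 2 :> R by rewrite s2; ring.
  by field; rewrite gt_eqF.
by field; rewrite gt_eqF.
Qed.

(** One admissible [z] suffices. With [b = 1 / (6 g)] and [c] the claimed coefficient,
    [kappa = 6 (c^2 - b^2)]; at the chosen [z] the term [z t^2 / 12] is [(c - b) |t|] and the
    maximum is [b |t|], together [c |t|]. *)
Lemma p_E_oo_le t g : 0 < g ->
  p_E t +oo%E g <= Num.sqrt (6 * kappa R * g ^+ 2 + 1) / (6 * g) * `|t| ^+ 3.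
Proof.
move=> g0; have k0 := kappa_gt0 R; set c := _ / (6 * g).
have [->|t0] := eqVneq t 0.
  by rewrite /p_E expr0n/= mul0r normr0 expr0n/= mulr0.
have tp : 0 < `|t| by rewrite normr_gt0.
pose b := (6 * g)^-1.
have q0 : 0 < 6 * kappa R * g ^+ 2 by rewrite !mulr_gt0 ?exprn_gt0.
have c2 : c ^+ 2 = (6 * kappa R * g ^+ 2 + 1) / (36 * g ^+ 2).
  rewrite /c expr_div_n sqr_sqrtr; last by lra.
  by congr (_ / _); ring.
have b0 : 0 < b by rewrite invr_gt0 mulr_gt0.
have c0 : 0 < c by rewrite divr_gt0 ?mulr_gt0// sqrtr_gt0; lra.
have bc : b < c.
  have -> : b = 1 * b by rewrite mul1r.
  rewrite /c ltr_pM2r//.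
  rewrite -[ltLHS]sqrtr1 ltr_sqrt; lra.
(* [z |t|] is the point where the two branches of the maximum coincide. *)
pose z := 12 * (c - b) / `|t|.
have z0 : 0 < z by rewrite divr_gt0// mulr_gt0// subr_gt0.
apply: (le_trans (p_E_le _ t +oo%E g z g0 z0 (leey _))).
have kE : kappa R = 6 * (c ^+ 2 - b ^+ 2) by rewrite c2 /b; field; rewrite gt_eqF.
have E2 : kappa R / z - z * t ^+ 2 / 24 = `|t| / (6 * g).
  rewrite kE -[t ^+ 2]real_normK ?num_real// -/b /z; field.
  by rewrite subr_eq0 !gt_eqF.
rewrite E2 max_l// -[t ^+ 2]real_normK ?num_real// le_eqVlt; apply/orP; left; apply/eqP.
by rewrite -/b /z; field; rewrite gt_eqF.
Qed.

Lemma inv_e_ge0 e : (0 < e)%E -> 0 <= inv_e e.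
Proof. by case: e => [r|_|//] //=; rewrite lte_fin invr_ge0 => /ltW. Qed.

Lemma inv_e_anti e1 e2 : (0 < e1)%E -> (e1 <= e2)%E -> inv_e e2 <= inv_e e1.
Proof.
move=> e0 e12; have e20 := lt_le_trans e0 e12.
case: e2 e20 e12 => [r2 r20|_ _|//]; last exact: inv_e_ge0.
case: e1 e0 => [r1 r10|//|//]; rewrite !lee_fin !lte_fin in r10 r20 *.
by move=> r12; rewrite /= lef_pV2 ?posrE.
Qed.

(** The maximum is at most the sum of its entries, and [z t^2 / 12 + kappa / z] is minimal at
    [z = 6 q / |t|] with value [|t| sqrt (kappa / 3)], the origin of this constant in [A_E]. If that
    level exceeds [e], the cut is at [e] itself, where [e t^2 / 12 <= q |t| / 2]. *)
Lemma p_E_upper t e g : (0 < e)%E -> 0 < g ->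
  p_E t e g <= t ^+ 2 * (`|t| / (6 * g) + Num.sqrt (kappa R / 3) * `|t| + kappa R * inv_e e).
Proof.
move=> e0 g0; have k0 := kappa_gt0 R; set q := Num.sqrt _.
have q0 : 0 < q by rewrite sqrtr_gt0 divr_gt0.
have kE : kappa R = 3 * q ^+ 2 by rewrite sqr_sqrtr; lra.
have [t0|t0] := eqVneq t 0; first by rewrite /p_E t0 expr0n/= !mul0r.
have tp : 0 < `|t| by rewrite normr_gt0.
have t2 : t ^+ 2 = `|t| ^+ 2 by rewrite real_normK ?num_real.
have ie := inv_e_ge0 _ e0.
have a0 : 0 <= `|t| / (6 * g) by rewrite divr_ge0// mulr_ge0// ltW.
have [ze|ez] := leP (6 * q / `|t|)%:E e.
  have z0 : 0 < 6 * q / `|t| by rewrite divr_gt0// mulr_gt0.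
  apply: (le_trans (p_E_le _ t e g _ g0 z0 ze)); apply: ler_wpM2l; first exact: sqr_ge0.
  have -> : 6 * q / `|t| * t ^+ 2 / 12 = q * `|t| / 2.
    by rewrite t2; field; rewrite gt_eqF.
  have -> : kappa R / (6 * q / `|t|) - 6 * q / `|t| * t ^+ 2 / 24 = q * `|t| / 4.
    by rewrite t2 kE; field; rewrite !gt_eqF.
  have kie : 0 <= kappa R * inv_e e by rewrite mulr_ge0// ltW.
  have qt : 0 < q * `|t| by rewrite mulr_gt0.
  have : Num.max (`|t| / (6 * g)) (q * `|t| / 4) <= `|t| / (6 * g) + q * `|t| / 4.
    by rewrite ge_max; apply/andP; split; lra.
  by move: (Num.max _ _) => m; lra.
case: e e0 ez ie => [r r0 ez ie|//|//].
rewrite lte_fin in r0; rewrite lte_fin in ez.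
apply: (le_trans (p_E_le _ t r%:E g _ g0 r0 (lexx _))).
apply: ler_wpM2l; first exact: sqr_ge0.
have h1 : r * t ^+ 2 / 12 <= q * `|t| / 2.
  rewrite ltr_pdivlMr// in ez; rewrite t2.
  by have := ler_wpM2r (ltW tp) (ltW ez); lra.
have rt0 : 0 <= r * t ^+ 2 by rewrite mulr_ge0 ?sqr_ge0// ltW.
have qt : 0 < q * `|t| by rewrite mulr_gt0.
have kr : 0 <= kappa R / r by rewrite divr_ge0// ltW.
have : Num.max (`|t| / (6 * g)) (kappa R / r - r * t ^+ 2 / 24) <=
    `|t| / (6 * g) + kappa R / r.
  by rewrite ge_max; apply/andP; split; lra.
by rewrite /=; move: (Num.max _ _) => m; lra.
Qed.

Lemma expR_sub1_le (x : R) : expR x - 1 <= x * expR x.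
Proof.
have := expR_ge1Dx (- x); rewrite expRN => h.
have := ler_wpM2r (expR_ge0 x) h; rewrite mulVf ?gt_eqF ?expR_gt0//; lra.
Qed.

(** The factor and the exponent are bounded separately: [y] keeps the order in [t], whereas [w] may
    be the cruder bound through [tau]. *)
Lemma expR_sub1_le_bound (x y w : R) : 0 <= x -> x <= y -> x <= w ->
  expR x - 1 <= expR w * y.
Proof.
move=> x0 xy xw; apply: (le_trans (expR_sub1_le x)); rewrite mulrC.
by rewrite ler_pM ?expR_ge0// ler_expR.
Qed.

(** * From the bounds of (i) to those of (ii) *)

Section small_fraction.
Variables (e : \bar R) (L t tau : R).
Hypotheses (e0 : (0 < e)%E) (Lp : 0 < L) (LL : (L%:E <= L0 e)%E).
(** Strict at [tau0 e]: there the denominator of [B2] vanishes and [B2] would take the default value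
    0. *)
Hypotheses (Lt : L * `|t| < tau) (tt : tau < tau0 e).

Let Lt0 : 0 <= L * `|t|. Proof. by rewrite mulr_ge0// ltW. Qed.
Let tau_ge0 : 0 <= tau. Proof. exact: le_trans (ltW Lt). Qed.

Lemma Lt_expr_le (k : nat) : (L * `|t|) ^+ k <= tau ^+ k.
Proof. by rewrite lerXn2r ?nnegrE// ltW. Qed.

Lemma rem_term_le_tau : rem_term R t e L <= tau ^+ 4 * B2 tau e.
Proof.
apply: (le_trans (rem_term_le _ _ _ _ _ e0 Lp LL Lt tt)).
apply: ler_wpM2r; first exact: B2_ge0.
by rewrite -(norm_expr4 R t) -exprMn Lt_expr_le.
Qed.

Lemma rhs1_E_le_rhs2_E g : 0 < g -> rhs1_E t e g L <= rhs2_E t tau e g L.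
Proof.
move=> g0; rewrite /rhs1_E /rhs2_E B3E//; apply: ler_wpM2r; first exact: expR_ge0.
have pe := p_E_ge0 _ t e g e0 g0; have k0 := kappa_gt0 R.
have L3 : 0 <= L ^+ 3 by rewrite exprn_ge0// ltW.
have rl := rem_term_le _ _ _ _ _ e0 Lp LL Lt tt.
rewrite /A_E /Afun -expRD -mulrA; apply: expR_sub1_le_bound.
- apply: addr_ge0; first exact: mulr_ge0.
  by apply: rem_term_ge0 => //; exact: lt_trans tt.
- by rewrite mulrDl [_ * L ^+ 3]mulrC lerD2l; apply: (le_trans rl); lra.
rewrite addrC lerD ?rem_term_le_tau//.
have := ler_wpM2l L3 (p_E_upper t e g e0 g0) => /le_trans; apply.
have t2 : t ^+ 2 = `|t| ^+ 2 by rewrite real_normK ?num_real.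
have -> : L ^+ 3 * (t ^+ 2 *
      (`|t| / (6 * g) + Num.sqrt (kappa R / 3) * `|t| + kappa R * inv_e e)) =
   (L * `|t|) ^+ 3 / (6 * g) + Num.sqrt (kappa R / 3) * (L * `|t|) ^+ 3 +
    kappa R * inv_e e * L * (L * `|t|) ^+ 2.
  by rewrite t2; field; rewrite gt_eqF.
rewrite !lerD//.
- by rewrite ler_wpM2r ?Lt_expr_le// invr_ge0 mulr_ge0// ltW.
- by rewrite ler_wpM2l ?Lt_expr_le// sqrtr_ge0.
- by rewrite ler_wpM2l ?Lt_expr_le// !mulr_ge0 ?inv_e_ge0// ltW.
Qed.

End small_fraction.

(** The part [L^3 t^2 (eps t^2 / 12)] of the exponent is not bounded by [tau] alone: it is at most
    [eps tau^2 L t^2 / 12] and moves into the Gaussian factor, which turns [t^2] into [h t^2]. For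
    [g >= gamma_star] the entry [|t| / (6 g)] is absorbed by its neighbour, whence the indicator in
    [A_R]. *)
Lemma rhs1_R_le_rhs2_R (eps L t tau g : R) : 0 < eps -> 0 < L ->
  (L%:E <= L0 eps%:E)%E -> L * `|t| < tau -> tau < tau0 eps%:E -> 0 < g ->
  rhs1_R t eps g L <= rhs2_R t tau eps g L.
Proof.
move=> e0 Lp LL Lt tt g0; rewrite /rhs1_R /rhs2_R B3E//.
have e0' : (0 < eps%:E)%E by [].
have pe := p_R_ge0 _ t eps g e0 g0; have k0 := kappa_gt0 R.
have L3 : 0 <= L ^+ 3 by rewrite exprn_ge0// ltW.
have rl := rem_term_le _ _ _ _ _ e0' Lp LL Lt tt.
have t2 : t ^+ 2 = `|t| ^+ 2 by rewrite real_normK ?num_real.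
set G := `|t| / (6 * g) * (if g < gamma_star R then 1 else 0).
have G0 : 0 <= G.
  rewrite mulr_ge0 ?divr_ge0 ?mulr_ge0 ?(ltW g0)//; by case: ifP.
have et0 : 0 <= eps * t ^+ 2 by rewrite mulr_ge0 ?sqr_ge0// ltW.
have ke0 : 0 <= kappa R / eps by rewrite divr_ge0// ltW.
have pu : p_R t eps g <= t ^+ 2 * (G + kappa R / eps + eps * t ^+ 2 / 12).
  apply: ler_wpM2l; first exact: sqr_ge0.
  rewrite !ge_max; apply/and3P; split; [|lra|lra].
  rewrite /G; have [gg|gg] := ltP g (gamma_star R); first by lra.
  by have := norm_div_gamma_le _ t eps g e0 gg; lra.
set A := expR (- (t ^+ 2) / 2).
have -> : A_R tau eps g L * (p_R t eps g + B2 tau eps%:E * L * t ^+ 4) * L ^+ 3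
    * expR (- (h_fun tau eps L * t ^+ 2) / 2) =
   expR (tau ^+ 4 * B2 tau eps%:E + (tau ^+ 3 / (6 * g) * (if g < gamma_star R then 1 else 0)
       + kappa R / eps * L * tau ^+ 2) + eps * tau ^+ 2 * L / 12 * t ^+ 2)
    * ((p_R t eps g + B2 tau eps%:E * L * t ^+ 4) * L ^+ 3) * A.
  rewrite expRD /A_R /Afun -expRD.
  have -> : expR (- (h_fun tau eps L * t ^+ 2) / 2) =
      expR (eps * tau ^+ 2 * L / 12 * t ^+ 2) * A.
    by rewrite -expRD; congr expR; rewrite /h_fun; field.
  by ring.
apply: ler_wpM2r; first exact: expR_ge0.
apply: expR_sub1_le_bound.
- apply: addr_ge0; first exact: mulr_ge0.
  by apply: rem_term_ge0 => //; exact: lt_trans tt.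
- by rewrite mulrDl [_ * L ^+ 3]mulrC lerD2l; apply: (le_trans rl); lra.
have rt := rem_term_le_tau _ _ _ _ e0' Lp LL Lt tt.
have Le := Lt_expr_le L t tau Lp Lt.
rewrite addrC -[leRHS]addrA lerD//.
have := ler_wpM2l L3 pu => /le_trans; apply.
have -> : L ^+ 3 * (t ^+ 2 * (G + kappa R / eps + eps * t ^+ 2 / 12)) =
   (L * `|t|) ^+ 3 / (6 * g) * (if g < gamma_star R then 1 else 0) +
    kappa R / eps * L * (L * `|t|) ^+ 2 + eps * L / 12 * (t ^+ 2 * (L * `|t|) ^+ 2).
  rewrite /G t2; move: (if _ then _ else _) => b.
  by field; rewrite !gt_eqF.
have -> : eps * tau ^+ 2 * L / 12 * t ^+ 2 = eps * L / 12 * (t ^+ 2 * tau ^+ 2) by ring.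
rewrite !lerD//.
- apply: ler_wpM2r; first by case: ifP.
  by rewrite ler_wpM2r ?Le// invr_ge0 mulr_ge0// ltW.
- by rewrite ler_wpM2l ?Le// mulr_ge0// ltW.
- apply: ler_wpM2l; first by rewrite divr_ge0// mulr_ge0// ltW.
  by apply: ler_wpM2l; rewrite ?sqr_ge0 ?Le.
Qed.

(** * The explicit bounds at [e = +oo] *)

Lemma rhs1_oo t g L : 0 < g -> 0 < L -> L * `|t| < 2 `^ (5 / 6) / Num.sqrt 3 ->
  rhs1_E t +oo%E g L <=
     (expR (Num.sqrt (6 * kappa R * g ^+ 2 + 1) / (6 * g) * L ^+ 3 * `|t| ^+ 3
              - 4 * Num.sqrt 2 * 3 `^ (- (3 / 2))
                * (ln (1 - 3 * 2 `^ (- (5 / 3)) * L ^+ 2 * t ^+ 2)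
                   + 3 * 2 `^ (- (5 / 3)) * L ^+ 2 * t ^+ 2)) - 1)
       * expR (- (t ^+ 2) / 2).
Proof.
move=> g0 Lp; rewrite -tau0_oo => Lt.
rewrite /rhs1_E B3E ?ltry// -rem_term_oo//.
apply: ler_wpM2r; first exact: expR_ge0.
have L3 : 0 <= L ^+ 3 by rewrite exprn_ge0// ltW.
by have := ler_wpM2l L3 (p_E_oo_le t g g0); rewrite lerD2r ler_expR lerD2r; lra.
Qed.

(** Rests on the sharper [p_E_oo_le] in place of [p_E_upper]: subadditivity of the square root gives
    [c <= 1 / (6 g) + sqrt (kappa / 6)], so [kappa / 6] replaces the [kappa / 3] of [A_E]. *)
Lemma rhs2_oo t tau g L : 0 < g -> 0 < L -> L * `|t| < tau ->
  tau < 2 `^ (5 / 6) / Num.sqrt 3 ->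
  rhs1_E t +oo%E g L <=
    expR (tau ^+ 3 / (6 * g) + Num.sqrt (kappa R / 6) * tau ^+ 3 + tau ^+ 4 * B_inf tau)
       * (Num.sqrt (6 * kappa R * g ^+ 2 + 1) / (6 * g) + B_inf tau * L * `|t|)
       * L ^+ 3 * `|t| ^+ 3 * expR (- (t ^+ 2) / 2).
Proof.
move=> g0 Lp Lt; rewrite -tau0_oo => tt.
have e0 : (0 < +oo :> \bar R)%E by rewrite ltry.
have LL : (L%:E <= L0 +oo%E)%E.
  by rewrite /L0 gt0_mulye ?leey// lte_fin tau0_gt0.
rewrite /rhs1_E B3E//; apply: ler_wpM2r; first exact: expR_ge0.
have pe := p_E_ge0 _ t +oo%E g e0 g0; have k0 := kappa_gt0 R.
have L3 : 0 <= L ^+ 3 by rewrite exprn_ge0// ltW.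
have rl := rem_term_le _ _ _ _ _ e0 Lp LL Lt tt.
have rt := rem_term_le_tau _ _ _ _ e0 Lp LL Lt tt.
have Le := Lt_expr_le L t tau Lp Lt.
rewrite B2_oo in rl rt.
have pl := ler_wpM2l L3 (p_E_oo_le t g g0).
set c := Num.sqrt _ / (6 * g) in pl *.
rewrite -(mulrA _ (L ^+ 3)) -[leRHS]mulrA; apply: expR_sub1_le_bound.
- apply: addr_ge0; first exact: mulr_ge0.
  by apply: rem_term_ge0 => //; exact: lt_trans tt.
- have -> : (c + B_inf tau * L * `|t|) * (L ^+ 3 * `|t| ^+ 3) =
     L ^+ 3 * (c * `|t| ^+ 3) + L ^+ 4 * `|t| ^+ 4 * B_inf tau by ring.
  by rewrite (norm_expr4 R t); exact: (lerD pl rl).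
rewrite lerD//; apply: (le_trans pl).
have cb : c <= (6 * g)^-1 + Num.sqrt (kappa R / 6).
  have s0 : 0 <= Num.sqrt (kappa R / 6) by exact: sqrtr_ge0.
  have sE : kappa R = 6 * Num.sqrt (kappa R / 6) ^+ 2 by rewrite sqr_sqrtr; lra.
  rewrite /c ler_pdivrMr ?mulr_gt0//.
  set s := Num.sqrt (kappa R / 6) in s0 sE *.
  have -> : ((6 * g)^-1 + s) * (6 * g) = 1 + s * (6 * g) by field; rewrite gt_eqF.
  have gs : 0 <= s * (6 * g) by rewrite mulr_ge0// mulr_ge0// ltW.
  rewrite -[leRHS]ger0_norm ?addr_ge0// -sqrtr_sqr ler_sqrt ?sqr_ge0// sE.
  by lra.
have -> : L ^+ 3 * (c * `|t| ^+ 3) = c * (L * `|t|) ^+ 3 by ring.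
have -> : tau ^+ 3 / (6 * g) + Num.sqrt (kappa R / 6) * tau ^+ 3 =
  ((6 * g)^-1 + Num.sqrt (kappa R / 6)) * tau ^+ 3 by ring.
apply: ler_pM => //; last by rewrite exprn_ge0// mulr_ge0// ltW.
by rewrite divr_ge0 ?sqrtr_ge0// mulr_ge0// ltW.
Qed.

(** * Monotonicity of the right-hand sides and the sign of [h_fun] *)

Lemma rhs1_E_mono_L t e g L1 L2 : (0 < e)%E -> 0 < g -> 0 < L1 -> L1 <= L2 ->
  L2 * `|t| < tau0 e -> rhs1_E t e g L1 <= rhs1_E t e g L2.
Proof.
move=> e0 g0 L10 L12 Lt; have L20 := lt_le_trans L10 L12.
rewrite /rhs1_E !B3E//; apply: ler_wpM2r; first exact: expR_ge0.
rewrite lerD2r ler_expR lerD ?rem_term_mono//.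
by rewrite ler_wpM2r ?p_E_ge0// lerXn2r// nnegrE ltW.
Qed.

Lemma rhs1_E_anti_g t e g1 g2 L : (0 < e)%E -> 0 < g1 -> g1 <= g2 -> 0 < L ->
  rhs1_E t e g2 L <= rhs1_E t e g1 L.
Proof.
move=> e0 g10 g12 Lp; apply: ler_wpM2r; first exact: expR_ge0.
rewrite lerD2r ler_expR lerD2r ler_wpM2l ?p_E_anti_g//.
by rewrite exprn_ge0// ltW.
Qed.

Lemma rhs1_E_anti_e t e1 e2 g L : (0 < e1)%E -> (e1 <= e2)%E -> 0 < g -> 0 < L ->
  L * `|t| < tau0 e1 -> rhs1_E t e2 g L <= rhs1_E t e1 g L.
Proof.
move=> e10 e12 g0 Lp Lt; have e20 := lt_le_trans e10 e12.
rewrite /rhs1_E !B3E//; apply: ler_wpM2r; first exact: expR_ge0.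
rewrite lerD2r ler_expR lerD ?rem_term_anti//.
by rewrite ler_wpM2l ?p_E_anti// exprn_ge0// ltW.
Qed.

Lemma rhs1_R_mono_L t (eps g L1 L2 : R) : 0 < eps -> 0 < g -> 0 < L1 -> L1 <= L2 ->
  L2 * `|t| < tau0 eps%:E -> rhs1_R t eps g L1 <= rhs1_R t eps g L2.
Proof.
move=> e0 g0 L10 L12 Lt; have L20 := lt_le_trans L10 L12.
rewrite /rhs1_R !B3E//; apply: ler_wpM2r; first exact: expR_ge0.
rewrite lerD2r ler_expR lerD ?rem_term_mono//.
by rewrite ler_wpM2r ?p_R_ge0// lerXn2r// nnegrE ltW.
Qed.

Lemma rhs1_R_anti_g t (eps g1 g2 L : R) : 0 < g1 -> g1 <= g2 -> 0 < L ->
  rhs1_R t eps g2 L <= rhs1_R t eps g1 L.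
Proof.
move=> g10 g12 Lp; apply: ler_wpM2r; first exact: expR_ge0.
rewrite lerD2r ler_expR lerD2r ler_wpM2l ?p_R_anti_g//.
by rewrite exprn_ge0// ltW.
Qed.

Lemma rhs2_E_mono_L t tau e g L1 L2 : (0 < e)%E -> 0 < g -> 0 < L1 -> L1 <= L2 ->
  L2 * `|t| < tau -> tau < tau0 e -> rhs2_E t tau e g L1 <= rhs2_E t tau e g L2.
Proof.
move=> e0 g0 L10 L12 Lt tt; have L20 := lt_le_trans L10 L12.
have tau_ge0 : 0 <= tau by apply: le_trans (ltW Lt); rewrite mulr_ge0// ltW.
have b0 := B2_ge0 _ _ _ e0 tau_ge0 tt; have p0 := p_E_ge0 _ t e g e0 g0.
have ie := inv_e_ge0 _ e0; have k0 := ltW (kappa_gt0 R).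
have t4 : 0 <= t ^+ 4 by rewrite exprn_even_ge0.
have pos L : 0 < L -> 0 <= p_E t e g + B2 tau e * L * t ^+ 4.
  by move=> Lp; rewrite addr_ge0// mulr_ge0// mulr_ge0// ltW.
rewrite /rhs2_E /A_E /Afun; apply: ler_wpM2r; first exact: expR_ge0.
apply: ler_pM; last by rewrite lerXn2r// nnegrE ltW.
- by rewrite mulr_ge0 ?pos// mulr_ge0 ?expR_ge0.
- by rewrite exprn_ge0// ltW.
apply: ler_pM; [by rewrite mulr_ge0 ?expR_ge0|exact: pos| |].
  apply: ler_wpM2l; first exact: expR_ge0.
  rewrite ler_expR lerD2l; apply: ler_wpM2r; first exact: sqr_ge0.
  by rewrite ler_wpM2l// mulr_ge0.
by rewrite lerD2l; apply: ler_wpM2r => //; rewrite ler_wpM2l.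
Qed.

Lemma rhs2_E_anti_e t tau e1 e2 g L : (0 < e1)%E -> (e1 <= e2)%E -> 0 < g -> 0 < L ->
  L * `|t| < tau -> tau < tau0 e1 -> rhs2_E t tau e2 g L <= rhs2_E t tau e1 g L.
Proof.
move=> e10 e12 g0 Lp Lt tt; have e20 := lt_le_trans e10 e12.
have tau_ge0 : 0 <= tau by apply: le_trans (ltW Lt); rewrite mulr_ge0// ltW.
have tt2 := lt_le_trans tt (tau0_anti _ _ _ e10 e12).
have b0 := B2_ge0 _ _ _ e20 tau_ge0 tt2; have p0 := p_E_ge0 _ t e2 g e20 g0.
have b12 := B2_anti _ _ _ _ e10 e12 tau_ge0 tt; have k0 := ltW (kappa_gt0 R).
have t4 : 0 <= t ^+ 4 by rewrite exprn_even_ge0.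
have Ln := ltW Lp.
rewrite /rhs2_E /A_E /Afun; apply: ler_wpM2r; first exact: expR_ge0.
apply: ler_wpM2r; first exact: exprn_ge0.
apply: ler_pM; first by rewrite mulr_ge0 ?expR_ge0.
- by rewrite addr_ge0// mulr_ge0// mulr_ge0.
- apply: ler_pM; rewrite ?expR_ge0// ler_expR.
    by rewrite ler_wpM2l// exprn_ge0.
  rewrite lerD2l; apply: ler_wpM2r; first exact: sqr_ge0.
  by apply: ler_wpM2r => //; rewrite ler_wpM2l// inv_e_anti.
- rewrite lerD ?p_E_anti//; apply: ler_wpM2r => //.
  by apply: ler_wpM2r.
Qed.

Lemma rhs2_E_anti_g t tau e g1 g2 L : (0 < e)%E -> 0 < g1 -> g1 <= g2 -> 0 < L ->
  L * `|t| < tau -> tau < tau0 e -> rhs2_E t tau e g2 L <= rhs2_E t tau e g1 L.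
Proof.
move=> e0 g10 g12 Lp Lt tt; have g20 := lt_le_trans g10 g12.
have tau_ge0 : 0 <= tau by apply: le_trans (ltW Lt); rewrite mulr_ge0// ltW.
have b0 := B2_ge0 _ _ _ e0 tau_ge0 tt; have p0 := p_E_ge0 _ t e g2 e0 g20.
have t4 : 0 <= t ^+ 4 by rewrite exprn_even_ge0.
have Ln := ltW Lp.
rewrite /rhs2_E /A_E /Afun; apply: ler_wpM2r; first exact: expR_ge0.
apply: ler_wpM2r; first exact: exprn_ge0.
apply: ler_pM; first by rewrite mulr_ge0 ?expR_ge0.
- by rewrite addr_ge0// mulr_ge0// mulr_ge0.
- apply: ler_wpM2l; first exact: expR_ge0.
  rewrite ler_expR !lerD2r; apply: ler_wpM2l; first exact: exprn_ge0.
  by rewrite lef_pV2 ?posrE; lra.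
- by rewrite lerD2r p_E_anti_g.
Qed.

Lemma rhs2_R_mono_L t tau (eps g L1 L2 : R) : 0 < eps -> 0 < g -> 0 < L1 -> L1 <= L2 ->
  L2 * `|t| < tau -> tau < tau0 eps%:E -> rhs2_R t tau eps g L1 <= rhs2_R t tau eps g L2.
Proof.
move=> e0 g0 L10 L12 Lt tt; have L20 := lt_le_trans L10 L12.
have tau_ge0 : 0 <= tau by apply: le_trans (ltW Lt); rewrite mulr_ge0// ltW.
have e0' : (0 < eps%:E)%E by [].
have b0 := B2_ge0 _ _ _ e0' tau_ge0 tt; have p0 := p_R_ge0 _ t eps g e0 g0.
have k0 := ltW (kappa_gt0 R).
have t4 : 0 <= t ^+ 4 by rewrite exprn_even_ge0.
have pos L : 0 < L -> 0 <= p_R t eps g + B2 tau eps%:E * L * t ^+ 4.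
  by move=> Lp; rewrite addr_ge0// mulr_ge0// mulr_ge0// ltW.
rewrite /rhs2_R /A_R /Afun; apply: ler_pM; [|exact: expR_ge0| |].
- apply: mulr_ge0; last by rewrite exprn_ge0// ltW.
  by apply: mulr_ge0; [rewrite mulr_ge0 ?expR_ge0|exact: pos].
- apply: ler_pM; last by rewrite lerXn2r// nnegrE ltW.
  + by rewrite mulr_ge0 ?pos// mulr_ge0 ?expR_ge0.
  + by rewrite exprn_ge0// ltW.
  apply: ler_pM; [by rewrite mulr_ge0 ?expR_ge0|exact: pos| |].
    apply: ler_wpM2l; first exact: expR_ge0.
    rewrite ler_expR lerD2l; apply: ler_wpM2r; first exact: sqr_ge0.
    by rewrite ler_wpM2l// divr_ge0// ltW.
  by rewrite lerD2l; apply: ler_wpM2r => //; rewrite ler_wpM2l.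
(* [h_fun] decreases in [L], so the last exponential increases as well. *)
- rewrite ler_expR; apply: ler_wpM2r => //; rewrite lerN2.
  apply: ler_wpM2r; first exact: sqr_ge0.
  rewrite /h_fun lerD2l lerN2; apply: ler_wpM2r => //.
  by rewrite ler_wpM2l// mulr_ge0 ?sqr_ge0// ltW.
Qed.

Lemma rhs2_R_anti_g t tau (eps g1 g2 L : R) : 0 < eps -> 0 < g1 -> g1 <= g2 -> 0 < L ->
  L * `|t| < tau -> tau < tau0 eps%:E -> rhs2_R t tau eps g2 L <= rhs2_R t tau eps g1 L.
Proof.
move=> e0 g10 g12 Lp Lt tt; have g20 := lt_le_trans g10 g12.
have tau_ge0 : 0 <= tau by apply: le_trans (ltW Lt); rewrite mulr_ge0// ltW.
have e0' : (0 < eps%:E)%E by [].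
have b0 := B2_ge0 _ _ _ e0' tau_ge0 tt; have p0 := p_R_ge0 _ t eps g2 e0 g20.
have t4 : 0 <= t ^+ 4 by rewrite exprn_even_ge0.
have Ln := ltW Lp.
rewrite /rhs2_R /A_R /Afun; apply: ler_wpM2r; first exact: expR_ge0.
apply: ler_wpM2r; first exact: exprn_ge0.
apply: ler_pM; first by rewrite mulr_ge0 ?expR_ge0.
- by rewrite addr_ge0// mulr_ge0// mulr_ge0.
- apply: ler_wpM2l; first exact: expR_ge0.
  rewrite ler_expR lerD2r; apply: ler_pM.
  + by rewrite divr_ge0 ?exprn_ge0// mulr_ge0// ltW.
  + by case: ifP.
  + apply: ler_wpM2l; first exact: exprn_ge0.
    by rewrite lef_pV2 ?posrE; lra.
  (* The indicator can only drop from 1 to 0 as [g] passes [gamma_star]. *)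
  + have [h2|_] := ltP g2 (gamma_star R); last by case: ifP.
    by rewrite (le_lt_trans g12 h2).
- by rewrite lerD2r p_R_anti_g.
Qed.

Lemma h_fun_gt0_iff (eps L : R) : 0 < eps -> 0 < L ->
  (forall tau, 0 < tau -> tau < tau0 eps%:E -> 0 < h_fun tau eps L)
  <-> L <= 6 / (eps * tau0 eps%:E ^+ 2).
Proof.
move=> e0 Lp; have t0 : 0 < tau0 eps%:E by apply: tau0_gt0.
have et : 0 < eps * tau0 eps%:E ^+ 2 by rewrite mulr_gt0// exprn_gt0.
have eL : 0 < eps * L by rewrite mulr_gt0.
rewrite ler_pdivlMr//; split => [h|h tau tau_gt0 tt].
  rewrite leNgt; apply/negP => h6.
  (* The zero of [h_fun] in [tau]; it falls below [tau0] as soon as [L] exceeds the bound. *)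
  pose tau := Num.sqrt (6 / (eps * L)).
  have tau2 : tau ^+ 2 = 6 / (eps * L) by rewrite sqr_sqrtr// divr_ge0// ltW.
  have tau_gt0 : 0 < tau by rewrite sqrtr_gt0 divr_gt0.
  have : tau < tau0 eps%:E.
    rewrite -(@ltr_pXn2r _ 2)// ?nnegrE ?ltW// tau2 ltr_pdivrMr//; lra.
  move=> /(h _ tau_gt0); rewrite /h_fun tau2.
  have -> : 1 - eps * (6 / (eps * L)) * L / 6 = 0 by field; rewrite !gt_eqF.
  by rewrite ltxx.
have : tau ^+ 2 < tau0 eps%:E ^+ 2 by rewrite ltrXn2r ?nnegrE ?ltW.
rewrite -(ltr_pM2l eL) /h_fun; lra.
Qed.

End right_hand_sides.

Theorem theorem5 (R : realType) (d : measure_display) (T : measurableType d)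
  (P : probability T R) (n : nat) (X : 'I_n -> {RV P >-> R}) :
  mutually_independent X ->
  (forall k, P.-integrable setT (EFin \o (fun w => X k w ^+ 2))) ->
  (forall k, ('E_P[X k] = 0)%E) ->
  \sum_(k < n) fine ('E_P[fun w => X k w ^+ 2]) = 1 ->
  (* (i), Esseen-type fraction, ε ∈ (0, +oo] *)
  (forall (e : \bar R) (g L : R), (0 < e)%E -> 0 < g -> 0 < L ->
     (L ^+ 3)%:E = LE3 X e g ->
     forall t : R, L * `|t| < tau0 e -> r_n X t <= rhs1_E t e g L) /\
  (* (i), Rozovskii-type fraction, ε ∈ (0, +oo) *)
  (forall eps g L : R, 0 < eps -> 0 < g -> 0 < L ->
     (L ^+ 3)%:E = LR3 X eps g ->
     forall t : R, L * `|t| < tau0 eps%:E -> r_n X t <= rhs1_R t eps g L) /\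
  (* (i), in particular ε = +oo *)
  (forall g L : R, 0 < g -> 0 < L -> (L ^+ 3)%:E = LE3 X +oo%E g ->
     forall t : R, L * `|t| < 2 `^ (5 / 6) / Num.sqrt 3 ->
     r_n X t <=
       (expR (Num.sqrt (6 * kappa R * g ^+ 2 + 1) / (6 * g) * L ^+ 3 * `|t| ^+ 3
              - 4 * Num.sqrt 2 * 3 `^ (- (3 / 2))
                * (ln (1 - 3 * 2 `^ (- (5 / 3)) * L ^+ 2 * t ^+ 2)
                   + 3 * 2 `^ (- (5 / 3)) * L ^+ 2 * t ^+ 2)) - 1)
       * expR (- (t ^+ 2) / 2)) /\
  (* (i), monotonicity of the right-hand sides *)
  (forall (t : R) (e : \bar R) (g L1 L2 : R), (0 < e)%E -> 0 < g -> 0 < L1 -> L1 <= L2 ->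
     L2 * `|t| < tau0 e -> rhs1_E t e g L1 <= rhs1_E t e g L2) /\
  (forall (t : R) (e : \bar R) (g1 g2 L : R), (0 < e)%E -> 0 < g1 -> g1 <= g2 -> 0 < L ->
     L * `|t| < tau0 e -> rhs1_E t e g2 L <= rhs1_E t e g1 L) /\
  (forall (t : R) (e1 e2 : \bar R) (g L : R), (0 < e1)%E -> (e1 <= e2)%E -> 0 < g -> 0 < L ->
     L * `|t| < tau0 e1 -> rhs1_E t e2 g L <= rhs1_E t e1 g L) /\
  (forall t eps g L1 L2 : R, 0 < eps -> 0 < g -> 0 < L1 -> L1 <= L2 ->
     L2 * `|t| < tau0 eps%:E -> rhs1_R t eps g L1 <= rhs1_R t eps g L2) /\
  (forall t eps g1 g2 L : R, 0 < eps -> 0 < g1 -> g1 <= g2 -> 0 < L ->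
     L * `|t| < tau0 eps%:E -> rhs1_R t eps g2 L <= rhs1_R t eps g1 L) /\
  (forall t eps g1 g2 L : R, 0 < eps -> gamma_star R <= g1 -> gamma_star R <= g2 -> 0 < L ->
     L * `|t| < tau0 eps%:E -> rhs1_R t eps g1 L = rhs1_R t eps g2 L) /\
  (* (ii), Esseen-type fraction *)
  (forall (e : \bar R) (g L : R), (0 < e)%E -> 0 < g -> 0 < L ->
     (L ^+ 3)%:E = LE3 X e g -> (L%:E <= L0 e)%E ->
     forall t tau : R, L * `|t| < tau -> tau < tau0 e ->
     r_n X t <= rhs2_E t tau e g L) /\
  (* (ii), in particular ε = +oo *)
  (forall g L : R, 0 < g -> 0 < L -> (L ^+ 3)%:E = LE3 X +oo%E g ->
     forall t tau : R, L * `|t| < tau -> tau < 2 `^ (5 / 6) / Num.sqrt 3 ->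
     r_n X t <=
       expR (tau ^+ 3 / (6 * g) + Num.sqrt (kappa R / 6) * tau ^+ 3 + tau ^+ 4 * B_inf tau)
       * (Num.sqrt (6 * kappa R * g ^+ 2 + 1) / (6 * g) + B_inf tau * L * `|t|)
       * L ^+ 3 * `|t| ^+ 3 * expR (- (t ^+ 2) / 2)) /\
  (* (ii), monotonicity of the Esseen-type right-hand side *)
  (forall (t tau : R) (e : \bar R) (g L1 L2 : R), (0 < e)%E -> 0 < g -> 0 < L1 -> L1 <= L2 ->
     (L2%:E <= L0 e)%E -> L2 * `|t| < tau -> tau < tau0 e ->
     rhs2_E t tau e g L1 <= rhs2_E t tau e g L2) /\
  (forall (t tau : R) (e1 e2 : \bar R) (g L : R), (0 < e1)%E -> (e1 <= e2)%E -> 0 < g -> 0 < L ->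
     (L%:E <= L0 e1)%E -> L * `|t| < tau -> tau < tau0 e1 ->
     rhs2_E t tau e2 g L <= rhs2_E t tau e1 g L) /\
  (forall (t tau : R) (e : \bar R) (g1 g2 L : R), (0 < e)%E -> 0 < g1 -> g1 <= g2 -> 0 < L ->
     (L%:E <= L0 e)%E -> L * `|t| < tau -> tau < tau0 e ->
     rhs2_E t tau e g2 L <= rhs2_E t tau e g1 L) /\
  (* (ii), Rozovskii-type fraction *)
  (forall eps g L : R, 0 < eps -> 0 < g -> 0 < L ->
     (L ^+ 3)%:E = LR3 X eps g -> (L%:E <= L0 eps%:E)%E ->
     forall t tau : R, L * `|t| < tau -> tau < tau0 eps%:E ->
     r_n X t <= rhs2_R t tau eps g L) /\
  (* positivity of h *)
  (forall eps L : R, 0 < eps -> 0 < L ->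
     ((forall tau : R, 0 < tau -> tau < tau0 eps%:E -> 0 < h_fun tau eps L)
      <-> L <= 6 / (eps * tau0 eps%:E ^+ 2))) /\
  (* (ii), monotonicity of the Rozovskii-type right-hand side *)
  (forall t tau eps g L1 L2 : R, 0 < eps -> 0 < g -> 0 < L1 -> L1 <= L2 ->
     (L2%:E <= L0 eps%:E)%E -> L2 * `|t| < tau -> tau < tau0 eps%:E ->
     rhs2_R t tau eps g L1 <= rhs2_R t tau eps g L2) /\
  (forall t tau eps g1 g2 L : R, 0 < eps -> 0 < g1 -> g1 <= g2 -> 0 < L ->
     (L%:E <= L0 eps%:E)%E -> L * `|t| < tau -> tau < tau0 eps%:E ->
     rhs2_R t tau eps g2 L <= rhs2_R t tau eps g1 L).
Proof.
move=> _ X2 EX0 sumX2.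
have rE := r_n_le_rhs1_E P n X X2 EX0 sumX2.
have rR := r_n_le_rhs1_R P n X X2 EX0 sumX2.
split; first by move=> e g L e0 g0 Lp LE t Lt; exact: rE.
split; first by move=> eps g L e0 g0 Lp LE t Lt; exact: rR.
split.
  move=> g L g0 Lp LE t Lt; apply: le_trans (rhs1_oo R t g L g0 Lp Lt).
  by apply: rE; rewrite ?ltry// tau0_oo.
split; first by move=> *; exact: rhs1_E_mono_L.
split; first by move=> *; exact: rhs1_E_anti_g.
split; first by move=> *; exact: rhs1_E_anti_e.
split; first by move=> *; exact: rhs1_R_mono_L.
split; first by move=> *; exact: rhs1_R_anti_g.
split.
  by move=> t eps g1 g2 L e0 h1 h2 _ _; rewrite /rhs1_R (p_R_const R t eps g1 g2).
split.
  move=> e g L e0 g0 Lp LE LL t tau Lt tt.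
  apply: le_trans (rhs1_E_le_rhs2_E R e L t tau e0 Lp LL Lt tt g g0).
  by apply: rE => //; exact: lt_trans tt.
split.
  move=> g L g0 Lp LE t tau Lt tt.
  apply: le_trans (rhs2_oo R t tau g L g0 Lp Lt tt).
  by apply: rE; rewrite ?ltry// tau0_oo; exact: lt_trans tt.
split; first by move=> t tau e g L1 L2 e0 g0 L10 L12 _; exact: rhs2_E_mono_L.
split; first by move=> t tau e1 e2 g L e0 e12 g0 Lp _; exact: rhs2_E_anti_e.
split; first by move=> t tau e g1 g2 L e0 g10 g12 Lp _; exact: rhs2_E_anti_g.
split.
  move=> eps g L e0 g0 Lp LE LL t tau Lt tt.
  apply: le_trans (rhs1_R_le_rhs2_R R eps L t tau g e0 Lp LL Lt tt g0).
  by apply: rR => //; exact: lt_trans tt.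
split; first by move=> *; exact: h_fun_gt0_iff.
split; first by move=> t tau eps g L1 L2 e0 g0 L10 L12 _; exact: rhs2_R_mono_L.
by move=> t tau eps g1 g2 L e0 g10 g12 Lp _; exact: rhs2_R_anti_g.
Qed.
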